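(* Assume that $\mathbb{E}(Y^4)<\infty$. Then, as $N\to\infty$, the following convergences in distribution hold: $$\sqrt{N}\,(S^X_N-S^X)\to \mathcal{N}_1(0,\sigma_S^2)\qquad\text{and}\qquad \sqrt{N}\,(T^X_N-S^X)\to \mathcal{N}_1(0,\sigma_T^2),$$ where $$\sigma_S^2=\frac{ \mathrm{Var}\left( ( Y-\mathbb{E}(Y) ) \left[ ( Y^X - \mathbb{E}(Y) ) - S^X ( Y - \mathbb{E}(Y) ) \right] \right)}{\left( \mathrm{Var}(Y) \right)^2},$$ $$\sigma_T^2=\frac{\mathrm{Var}\left( (Y-\mathbb{E}(Y))(Y^X-\mathbb{E}(Y)) - \frac{S^X}{2} \left( (Y-\mathbb{E}(Y))^2+(Y^X-\mathbb{E}(Y))^2 \right) \right)}{(\mathrm{Var}(Y))^2}.$$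
   Context: Let $X\in\mathbb{R}^{p_1}$ and $Z\in\mathbb{R}^{p_2}$ be independent random vectors, $f$ a deterministic (measurable) real-valued function, $Z'$ an independent copy of $Z$, independent of $(X,Z)$, and $Y=f(X,Z)$, $Y^X=f(X,Z')$. Assume $Y$ is square integrable with $\mathrm{Var}(Y)\neq 0$. The Sobol index is $S^X=\mathrm{Var}(\mathbb{E}(Y|X))/\mathrm{Var}(Y)$. Let $(X_i,Z_i,Z_i')_{i\ge 1}$ be i.i.d. copies of $(X,Z,Z')$, and $Y_i=f(X_i,Z_i)$, $Y_i^X=f(X_i,Z_i')$. With all sums over $i=1,\dots,N$, define the estimators $$S^X_N = \frac{ \frac{1}{N} \sum Y_i Y_i^X - \left(\frac{1}{N} \sum Y_i\right) \left(\frac{1}{N}\sum Y_i^X\right) }{ \frac{1}{N}\sum Y_i^2 - \left( \frac{1}{N} \sum Y_i \right)^2 },\qquad T^X_N = \frac{ \frac{1}{N} \sum Y_i Y_i^X - \left(\frac{1}{N} \sum \frac{Y_i+Y_i^X}{2}\right)^2 }{ \frac{1}{N}\sum \frac{Y_i^2+(Y_i^X)^2}{2} - \left( \frac{1}{N} \sum \frac{Y_i+Y_i^X}{2} \right)^2 },$$ (with an arbitrary fixed value when a denominator vanishes). $\mathcal{N}_1(\mu,\sigma^2)$ is the Gaussian distribution with mean $\mu$ and variance $\sigma^2$ (a point mass at $\mu$ if $\sigma^2=0$). *)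

(* Defs.v *)
From HB Require Import structures.
From mathcomp Require Import all_boot all_order all_algebra.
From mathcomp Require Import all_classical all_reals all_analysis.
Set Implicit Arguments.
Unset Strict Implicit.
Unset Printing Implicit Defensive.
Import Order.TTheory GRing.Theory Num.Theory.
Import numFieldNormedType.Exports.

Local Open Scope classical_set_scope.
Local Open Scope ring_scope.

(* The space R^p is rendered as p.-tuple R, whose canonical sigma-algebra (the
   one generated by the coordinates) is the Borel sigma-algebra of R^p. *)

Section random_elements.
Context d (T : measurableType d) (R : realType) (P : probability T R).
Context d1 d2 (T1 : measurableType d1) (T2 : measurableType d2).

Definition independent (U : T -> T1) (V : T -> T2) : Prop :=
  forall (A : set T1) (B : set T2), measurable A -> measurable B ->
    P (U @^-1` A `&` V @^-1` B) = (P (U @^-1` A) * P (V @^-1` B))%E.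

Definition same_law (U V : T -> T1) : Prop :=
  forall A : set T1, measurable A -> P (U @^-1` A) = P (V @^-1` A).

Definition mutually_independent (W : nat -> T -> T1) : Prop :=
  forall (J : seq nat) (A : nat -> set T1), uniq J ->
    (forall i, measurable (A i)) ->
    P (\bigcap_(i in [set` J]) (W i @^-1` A i)) =
    (\prod_(i <- J) P (W i @^-1` A i))%E.

Definition iid_copies (W : nat -> T -> T1) (W0 : T -> T1) : Prop :=
  mutually_independent W /\ forall i, same_law (W i) W0.

End random_elements.

Section conditional_expectation.
Context d (T : measurableType d) (R : realType) (P : probability T R).
Context d1 (T1 : measurableType d1).

Definition is_cond_expectation (X : T -> T1) (Y C : T -> R) : Prop :=
  [/\ measurable_fun [set: g_sigma_algebra_preimageType X] C,
      P.-integrable [set: T] (EFin \o C) &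
      forall A : set T, g_sigma_algebra_preimage X A ->
        \int[P]_(w in A) (C w)%:E = \int[P]_(w in A) (Y w)%:E]%E.

(* A chosen version of E(Y|X); one exists when X is measurable and Y integrable,
   and any two versions are almost surely equal. *)
Definition cond_expectation (X : T -> T1) (Y : T -> R) : T -> R :=
  xget (cst 0) [set C | is_cond_expectation X Y C].

Definition mean (Y : T -> R) : R := fine 'E_P[Y].

Definition var (Y : T -> R) : R := fine 'V_P[Y].

Definition sobol_index (X : T -> T1) (Y : T -> R) : R :=
  var (cond_expectation X Y) / var Y.

End conditional_expectation.

Section estimators.
Context (R : realType).

Definition emp_mean (N : nat) (u : nat -> R) : R := N%:R^-1 * \sum_(i < N) u i.

(* [c] is the arbitrary value taken when the denominator vanishes; [y] and
   [yX] are the samples (Y_i) and (Y_i^X), indexed from 0. *)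
Definition sobol_S (c : R) (N : nat) (y yX : nat -> R) : R :=
  let num := emp_mean N (fun i => y i * yX i) - emp_mean N y * emp_mean N yX in
  let den := emp_mean N (fun i => y i ^+ 2) - emp_mean N y ^+ 2 in
  if den == 0 then c else num / den.

Definition sobol_T (c : R) (N : nat) (y yX : nat -> R) : R :=
  let m := emp_mean N (fun i => (y i + yX i) / 2) in
  let num := emp_mean N (fun i => y i * yX i) - m ^+ 2 in
  let den := emp_mean N (fun i => (y i ^+ 2 + yX i ^+ 2) / 2) - m ^+ 2 in
  if den == 0 then c else num / den.

End estimators.

Section convergence_in_distribution.
Context (R : realType).

(* The second parameter is the variance, while that of [normal_prob] is the
   standard deviation; [normal_prob m 0] is not the point mass at [m]. *)
Definition gaussian (m v : R) : probability (measurableTypeR R) R :=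
  if v == 0 then (\d_(m : measurableTypeR R) : probability _ _)
  else (normal_prob m (Num.sqrt v) : probability _ _).

Definition cvg_in_distribution d (T : measurableType d) (P : probability T R)
    (U : nat -> T -> R) (mu : probability (measurableTypeR R) R) : Prop :=
  forall g : R -> R, continuous g -> (exists M, forall x, `|g x| <= M) ->
    ('E_P[g \o U n])%E @[n --> \oo] --> (\int[mu]_x (g x)%:E)%E.

End convergence_in_distribution.

(* Main.v *)
Require Import Defs.
From HB Require Import structures.
From mathcomp Require Import all_boot all_order all_algebra.
From mathcomp Require Import all_classical all_reals all_analysis.
From mathcomp Require Import measurable_realfun.
From mathcomp Require Import ring lra.
Import Order.TTheory GRing.Theory Num.Theory.
Import numFieldNormedType.Exports.
Set Implicit Arguments.
Unset Strict Implicit.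
Unset Printing Implicit Defensive.
Local Open Scope classical_set_scope.
Local Open Scope ring_scope.

(** Write [y], [z] for [Y - E Y] and [Y^X - E Y], [V] for [Var Y], [S] for the
    Sobol index, and [A] for the empirical mean.  Both estimators are invariant
    under translation of the data, so their errors are exactly
      [(A (y (z - S y)) + S A(y)^2 - A(y) A(z)) / D],
        with [D = V + A (y^2 - V) - A(y)^2],
      [(A (y z - S (y^2 + z^2) / 2) + (S - 1) A(b)^2) / D'],
        with [D' = V + A ((y^2 + z^2) / 2 - V) - A(b)^2] and [b = (y + z) / 2]
    ([sobol_S_error], [sobol_T_error]).  The first term of each numerator is an
    empirical mean of independent copies of a variable [xi], square integrable
    because [E Y^4] is finite, and centered because [S V = E (y z)]: given [X],
    the variables [Y] and [Y^X] are independent with the same conditional mean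
    ([sobol_var]).  The central limit theorem gives the limit of
    [sqrt N A(xi) / V]; its variance is the one announced.

    Everything else is negligible ([ratio_clt]).  With [q = N^(1/4)], the
    mean square of [q A(k)] is [E k^2 / sqrt N] for every centered square
    integrable [k], so [q A(k)] tends to 0.  The quadratic terms are products of two such quantities,
    and so is the effect [sqrt N A(xi) (1/D - 1/V)] of the random denominator, as
    [q (V - D) -> 0].

    The central limit theorem ([central_limit_taylor]) is proved by replacing the
    summands by Gaussian ones one at a time.  The remaining Gaussian noise is
    integrated out first, so it only appears as an operator on test functions;
    these operators form a semigroup ([normal_semigroup]) and preserve the class
    of functions with a uniform third-order Taylor bound ([taylor2_average]).
    Two summands with the same mean and variance then have the same effect up
    to [E (xi^2 min (1, |xi| / sqrt N)) / N], and the [N] errors add up to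
    something that vanishes by dominated convergence.  Finally, smooth test
    functions are enough ([cvg_in_distribution_taylor]) because a bounded
    continuous function is uniformly approximated on every segment by sums of
    smooth steps. *)

Notation intble P f := (P.-integrable [set: _] (EFin \o f)).

(** * Laws, independence and iterated integrals *)

Lemma integral_law d (T : measurableType d) (R : realType)
  (P : probability T R) d1 (T1 : measurableType d1) (U : {mfun T >-> T1}) (h : T1 -> \bar R) :
  measurable_fun setT h ->
  (\int[distribution P U]_x h x = \int[P]_w h (U w))%E.
Proof.
move=> mh; rewrite integralE [RHS]integralE.
by congr (_ - _)%E; rewrite ge0_integral_distribution//;
  [| exact: measurable_funepos| | exact: measurable_funeneg];
  apply: eq_integral => w _; rewrite !unlock.
Qed.

Section laws.
Context d (T : measurableType d) (R : realType) (P : probability T R).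
Context d1 d2 (T1 : measurableType d1) (T2 : measurableType d2).

Lemma same_law_integral (U V : T -> T1) (h : T1 -> \bar R) :
  measurable_fun setT U -> measurable_fun setT V -> same_law P U V ->
  measurable_fun setT h ->
  (\int[P]_w h (U w) = \int[P]_w h (V w))%E.
Proof.
move=> mU mV UV mh.
pose U' : {mfun T >-> T1} := HB.pack U (isMeasurableFun.Build _ _ _ _ U mU).
pose V' : {mfun T >-> T1} := HB.pack V (isMeasurableFun.Build _ _ _ _ V mV).
rewrite -(integral_law P U' mh) -(integral_law P V' mh).
by apply: eq_measure_integral => A mA _; exact: UV.
Qed.

Lemma same_law_integrable (U V : T -> T1) (h : T1 -> R) :
  measurable_fun setT U -> measurable_fun setT V -> same_law P U V ->
  measurable_fun setT h ->
  intble P (h \o V) -> intble P (h \o U).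
Proof.
move=> mU mV UV mh /integrableP[_ hV]; apply/integrableP; split.
  by apply/measurable_EFinP; exact: measurableT_comp.
rewrite (@same_law_integral U V (fun x => `|(h x)%:E|%E))//.
by apply: measurableT_comp => //; exact/measurable_EFinP.
Qed.

(** Independence says that the law of [(U, V)] agrees with the product of the
    laws on rectangles, hence everywhere, and Tonelli applies to the product. *)
Lemma ge0_independent_integral (U : T -> T1) (V : T -> T2)
    (h : T1 * T2 -> \bar R) :
  measurable_fun setT U -> measurable_fun setT V -> independent P U V ->
  measurable_fun setT h -> (forall x, 0 <= h x)%E ->
  (\int[P]_w h (U w, V w) = \int[P]_w \int[P]_w' h (U w, V w'))%E.
Proof.
move=> mU mV UV mh h0.
pose U' : {mfun T >-> T1} := HB.pack U (isMeasurableFun.Build _ _ _ _ U mU).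
pose V' : {mfun T >-> T2} := HB.pack V (isMeasurableFun.Build _ _ _ _ V mV).
have mUV : measurable_fun setT (fun w => (U w, V w)).
  exact: measurable_fun_pair.
pose W' : {mfun T >-> (T1 * T2)%type} :=
  HB.pack (fun w => (U w, V w)) (isMeasurableFun.Build _ _ _ _ _ mUV).
have FT := fubini_tonelli1 (m1 := distribution P U')
  (m2 := distribution P V') h mh h0.
apply: (etrans _ (etrans FT _)).
  rewrite -(@ge0_integral_distribution _ _ _ _ _ P W' h)//.
  apply: eq_measure_integral => A mA _; apply/esym.
  by apply: product_measure_unique.
rewrite (@ge0_integral_distribution _ _ _ _ _ P U')//=.
- apply: eq_integral => w _; rewrite /= /fubini_F.
  rewrite (@ge0_integral_distribution _ _ _ _ _ P V' (fun y => h (U w, y)))//.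
  by apply: measurableT_comp => //; exact: measurable_pair1.
- exact: measurable_fun_fubini_tonelli_F.
- by move=> x; apply: integral_ge0.
Qed.

Lemma independent_integral (U : T -> T1) (V : T -> T2) (h : T1 * T2 -> R) :
  measurable_fun setT U -> measurable_fun setT V -> independent P U V ->
  measurable_fun setT h -> intble P (fun w => h (U w, V w)) ->
  P.-integrable setT (fun w => \int[P]_w' (h (U w, V w'))%:E)%E /\
  (\int[P]_w (h (U w, V w))%:E = \int[P]_w \int[P]_w' (h (U w, V w'))%:E)%E.
Proof.
move=> mU mV UV mh ih.
pose U' : {mfun T >-> T1} := HB.pack U (isMeasurableFun.Build _ _ _ _ U mU).
pose V' : {mfun T >-> T2} := HB.pack V (isMeasurableFun.Build _ _ _ _ V mV).
have mUV : measurable_fun setT (fun w => (U w, V w)).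
  exact: measurable_fun_pair.
pose W' : {mfun T >-> (T1 * T2)%type} :=
  HB.pack (fun w => (U w, V w)) (isMeasurableFun.Build _ _ _ _ _ mUV).
have mhE : measurable_fun setT (EFin \o h) by exact/measurable_EFinP.
have prodE A : measurable A ->
    (distribution P U' \x distribution P V')%E A = distribution P W' A.
  by move=> mA; apply: product_measure_unique.
have iprod : (distribution P U' \x distribution P V')%E.-integrable setT
    (EFin \o h).
  apply/integrableP; split => //.
  rewrite (eq_measure_integral (distribution P W')); last first.
    by move=> A mA _; exact: prodE.
  rewrite (@ge0_integral_distribution _ _ _ _ _ P W')//; last first.
    by apply: measurableT_comp.
  by case/integrableP : ih.
have FE w : fubini_F (distribution P V') (EFin \o h) (U w) =
    (\int[P]_w' (h (U w, V w'))%:E)%E.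
  have mhw : measurable_fun setT (fun y => (h (U w, y))%:E).
    by apply/measurable_EFinP; apply: measurableT_comp => //; exact: measurable_pair1.
  rewrite /fubini_F (integral_law P V')//.
have iF := integrable_fubini_F iprod.
have iFU : P.-integrable setT
    (fubini_F (distribution P V') (EFin \o h) \o U').
  apply/integrableP; split.
    by apply: measurableT_comp => //; exact: measurable_int iF.
  case/integrableP : iF => mF; rewrite ge0_integral_distribution//.
  exact: measurableT_comp.
split.
  by apply: eq_integrable iFU => // w _; rewrite /= FE.
transitivity (\int[distribution P W']_x (h x)%:E)%E.
  by rewrite integral_law.
have E := integral12_prod_meas1 iprod.
apply: (etrans _ (etrans (esym E) _)).
  by apply: eq_measure_integral => A mA _; exact/esym/prodE.
rewrite integral_law; last exact: measurable_int iF.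
by apply: eq_integral => w _; rewrite /= FE.
Qed.

End laws.

(** * Independence of an observation from the past *)

Section prefix_independence.
Context d (T : measurableType d) (R : realType) (P : probability T R).
Context d1 (T1 : measurableType d1).
Variables (W : nat -> T -> T1) (mW : forall i, measurable_fun setT (W i)).

(** A pi-system that generates the sigma-algebra of the first [n] observations;
    unconstrained coordinates are obtained with [A i = setT]. *)
Definition past_cylinders (n : nat) : set_system T :=
  [set B | exists2 A : nat -> set T1, forall i, measurable (A i) &
     B = \bigcap_(i in [set` iota 0 n]) (W i @^-1` A i)].

Let mpre i A : measurable A -> measurable (W i @^-1` A).
Proof. by move=> mA; rewrite -[X in measurable X]setTI; exact: mW. Qed.

Lemma past_cylinders_measurable n : past_cylinders n `<=` measurable.
Proof.
move=> _ [A mA ->]; apply: bigcap_measurableType => i _.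
exact: mpre.
Qed.

Lemma past_cylinders_setI n : setI_closed (past_cylinders n).
Proof.
move=> _ _ [A mA ->] [B mB ->]; exists (fun i => A i `&` B i).
  by move=> i; exact: measurableI.
by rewrite -bigcapI.
Qed.

(** For a fixed event [D] on the [n]-th observation, the measures [B |-> P (B `&` D)]
    and [B |-> P D * P B] agree on cylinders, hence on the sigma-algebra they
    generate. *)
Lemma past_cylinders_independent n :
  mutually_independent P W ->
  forall B, <<s past_cylinders n >> B -> forall C, measurable C ->
  P (B `&` W n @^-1` C) = (P B * P (W n @^-1` C))%E.
Proof.
move=> iW B sB C mC; set D := W n @^-1` C.
have mD : measurable D by exact: mpre.
have PD : (P D)%E = (fine (P D))%:E by rewrite fineK// fin_num_measure.
pose r : {nonneg R} := NngNum (fine_ge0 (measure_ge0 P D)).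
suff : mrestr P mD B = mscale r P B by rewrite /=/mrestr/mscale/= -PD muleC.
pose H := [set X | past_cylinders n X /\ X `<=` setT].
have HE : H = past_cylinders n.
  by apply/seteqP; split => X; [case|].
apply: (g_sigma_algebra_measure_unique_trace (past_cylinders n) setT) => //.
- by move=> X [/past_cylinders_measurable].
- by rewrite -/H HE; exact: past_cylinders_setI.
- by rewrite /=/mrestr/mscale/= setTI -PD probability_setT mule1.
- move=> _ [[A mA ->] _]; rewrite /=/mrestr/mscale/= -PD.
  have nJ : n \notin iota 0 n by rewrite mem_iota add0n ltnn andbF.
  pose A' i := if i == n then C else A i.
  have A'A i : i \in iota 0 n -> A' i = A i.
    by rewrite /A'; case: eqP => // -> /negPn; rewrite nJ.
  have -> : \bigcap_(i in [set` iota 0 n]) (W i @^-1` A i) `&` D =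
      \bigcap_(i in [set` n :: iota 0 n]) (W i @^-1` A' i).
    apply/seteqP; split => [w [wA wD] i /=|w wA].
      rewrite inE => /predU1P[->|iJ]; first by rewrite /A' eqxx.
      by rewrite A'A//; exact: wA.
    split; last by have := wA n; rewrite /= /A' eqxx; apply; rewrite mem_head.
    by move=> i iJ; rewrite -A'A//; apply: wA; rewrite /= inE; apply/orP; right.
  rewrite iW; first last.
  + by move=> i; rewrite /A'; case: ifP.
  + by rewrite /= nJ iota_uniq.
  rewrite iW ?iota_uniq// big_cons [in X in (X * _)%E]/A' eqxx; congr (_ * _)%E.
  by rewrite big_seq [RHS]big_seq; apply: eq_bigr => i /A'A ->.
- by rewrite /=/mrestr/= setTI PD ltry.
- by rewrite -/H HE.
Qed.

(** The sum is measurable for the sigma-algebra generated by the past cylinders. *)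
Lemma prefix_sum_independent (k : T1 -> R) n : measurable_fun setT k ->
  mutually_independent P W ->
  independent P (fun w => \sum_(i < n) k (W i w)) (W n).
Proof.
move=> mk iW A B mA mB; apply: past_cylinders_independent => //.
have mWG (i : 'I_n) : @measurable_fun _ _ (g_sigma_algebraType (past_cylinders n))
    _ setT (W i).
  move=> _ C mC; rewrite setTI; apply: sub_sigma_algebra.
  exists (fun j => if j == i :> nat then C else setT).
    by move=> j; case: ifP.
  apply/seteqP; split => [w Cw j _|w /(_ i)/=]; first by case: eqP => [->|].
  by rewrite eqxx; apply; rewrite mem_iota add0n ltn_ord.
have mS : @measurable_fun _ _ (g_sigma_algebraType (past_cylinders n)) _ setT
    (fun w => \sum_(i < n) k (W i w)).
  apply: measurable_sum => i.
  by apply: (measurableT_comp mk); exact: mWG.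
by have := mS measurableT A mA; rewrite setTI.
Qed.

End prefix_independence.

(** * Integrable and square integrable variables *)

Section expectation_toolkit.
Context d (T : measurableType d) (R : realType) (P : probability T R).
Implicit Types f g : T -> R.

Lemma intble_measurable f : intble P f -> measurable_fun setT f.
Proof. by move=> /measurable_int/measurable_EFinP. Qed.

Lemma intble_dom f g : measurable_fun setT f -> (forall w, `|f w| <= g w) ->
  intble P g -> intble P f.
Proof.
move=> mf fg; apply: le_integrable => //; first exact/measurable_EFinP.
move=> w _; rewrite /= lee_fin (le_trans (fg w))//.
exact: ler_norm.
Qed.

Lemma intble_cst (c : R) : intble P (fun=> c).
Proof. by apply: finite_measure_integrable_cst. Qed.

Lemma intble_bounded f (M : R) : measurable_fun setT f ->
  (forall w, `|f w| <= M) -> intble P f.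
Proof. by move=> mf fM; apply: intble_dom mf fM (intble_cst M). Qed.

Lemma intbleD f g : intble P f -> intble P g -> intble P (fun w => f w + g w).
Proof.
by move=> f1 g1; apply: eq_integrable (integrableD _ f1 g1).
Qed.

Lemma intbleB f g : intble P f -> intble P g -> intble P (fun w => f w - g w).
Proof.
by move=> f1 g1; apply: eq_integrable (integrableB _ f1 g1).
Qed.

Lemma intbleZ (c : R) f : intble P f -> intble P (fun w => c * f w).
Proof.
by move=> f1; apply: eq_integrable (integrableZl _ c f1).
Qed.

Lemma Rint_cst (c : R) : \int[P]_w c = c.
Proof. by rewrite Rintegral_cst//= probability_setT mulr1. Qed.

Lemma Rint_dist f g (c : R) h : intble P f -> intble P g -> intble P h ->
  (forall w, `|f w - g w| <= h w) ->
  `|\int[P]_w f w - \int[P]_w g w| <= \int[P]_w h w.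
Proof.
move=> f1 g1 h1 fgh; rewrite -RintegralB//.
apply: (le_trans (le_normr_Rintegral _ (intbleB f1 g1))) => //.
apply: le_Rintegral => //.
by apply: integrable_norm => //; exact: intbleB.
Qed.

Lemma Rint_nonint f : measurable_fun setT f -> ~ intble P f ->
  \int[P]_w f w = 0.
Proof.
move=> mf nf; rewrite /Rintegral.
have : ~~ ((\int[P]_w (f w)%:E)%E \is a fin_num).
  rewrite -integral_fin_num_abs//; apply/negP => h; apply: nf.
  by apply/integrableP; split => //; exact/measurable_EFinP.
by case: (integral _ _ _).
Qed.

(** If [f] is not integrable, neither is [c * f] for [c != 0], and then both
    integrals have the default value 0. *)
Lemma Rint_scale (c : R) f : measurable_fun setT f ->
  \int[P]_w (c * f w) = c * \int[P]_w f w.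
Proof.
move=> mf; have [if1|nf] := pselect (intble P f); first exact: RintegralZl.
rewrite (Rint_nonint mf nf) mulr0.
have [->|c0] := eqVneq c 0.
  by under eq_Rintegral do rewrite mul0r; rewrite Rint_cst.
apply: Rint_nonint; first exact: measurable_funM.
move=> icf; apply: nf; have := intbleZ c^-1 icf.
by apply: eq_integrable => // w _; rewrite /= mulKf.
Qed.

Definition sqint f := measurable_fun setT f /\ intble P (fun w => f w ^+ 2).

Lemma sqint_mul f g : sqint f -> sqint g -> intble P (fun w => f w * g w).
Proof.
move=> [mf f2] [mg g2].
apply: intble_dom (intbleD f2 g2); first exact: measurable_funM.
move=> w; rewrite ler_norml; apply/andP; split.
  by have := sqr_ge0 (f w + g w); have := sqr_ge0 (f w); have := sqr_ge0 (g w); nra.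
by have := sqr_ge0 (f w - g w); have := sqr_ge0 (f w); have := sqr_ge0 (g w); nra.
Qed.

Lemma sqint_cst c : sqint (fun=> c).
Proof. by split => //; exact: intble_cst. Qed.

Lemma sqint_intble f : sqint f -> intble P f.
Proof.
move=> f2; have := sqint_mul f2 (sqint_cst 1).
by under eq_fun do rewrite mulr1.
Qed.

Lemma sqintD f g : sqint f -> sqint g -> sqint (fun w => f w + g w).
Proof.
move=> f2 g2; have fg := sqint_mul f2 g2; case: f2 g2 => [mf f2] [mg g2].
split; first exact: measurable_funD.
have := intbleD (intbleD f2 (intbleZ 2 fg)) g2.
by apply: eq_integrable => // w _; rewrite /=; congr EFin; ring.
Qed.

Lemma sqintZ c f : sqint f -> sqint (fun w => c * f w).
Proof.
move=> [mf f2]; split; first exact: measurable_funM.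
have := intbleZ (c ^+ 2) f2.
by apply: eq_integrable => // w _; rewrite /=; congr EFin; ring.
Qed.

Lemma sqintB f g : sqint f -> sqint g -> sqint (fun w => f w - g w).
Proof.
move=> f2 g2; have := sqintD f2 (sqintZ (-1) g2).
by under eq_fun do rewrite mulN1r.
Qed.

End expectation_toolkit.

Section independent_Rintegral.
Context d (T : measurableType d) (R : realType) (P : probability T R).
Context d1 d2 (T1 : measurableType d1) (T2 : measurableType d2).

(** The inner integral may be infinite, but only on a negligible set, where [fine]
    replaces it by 0 at no cost. *)
Lemma independent_Rintegral (U : T -> T1) (V : T -> T2) (h : T1 * T2 -> R) :
  measurable_fun setT U -> measurable_fun setT V -> independent P U V ->
  measurable_fun setT h -> intble P (fun w => h (U w, V w)) ->
  intble P (fun w => \int[P]_w' h (U w, V w')) /\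
  \int[P]_w h (U w, V w) = \int[P]_w \int[P]_w' h (U w, V w').
Proof.
move=> mU mV UV mh ih.
have [iF FE] := independent_integral mU mV UV mh ih.
set F := (fun w => _) in iF.
have mF : measurable_fun setT F := measurable_int _ iF.
have mfF : measurable_fun setT (fun w => fine (F w)) by exact: measurableT_comp.
have ifF : intble P (fun w => fine (F w)).
  apply: le_integrable iF => //; first exact/measurable_EFinP.
  by move=> w _; rewrite /=; case: (F w) => [r| |] /=; rewrite ?normr0 ?leey ?lexx.
split; first exact: ifF.
rewrite {1}/Rintegral FE; congr fine; apply: ae_eq_integral => //.
  exact/measurable_EFinP.
have := integrable_ae measurableT iF.
by apply: filterS => w H _; rewrite /Rintegral fineK// H.
Qed.

End independent_Rintegral.

Section iid_sums.
Context d (T : measurableType d) (R : realType) (P : probability T R).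
Context d1 (T1 : measurableType d1).
Variables (W : nat -> T -> T1) (mW : forall i, measurable_fun setT (W i)).
Variables (W0 : T -> T1) (mW0 : measurable_fun setT W0).
Hypothesis iW : iid_copies P W W0.
Variable (k : T1 -> R).
Hypothesis mk : measurable_fun setT k.

Lemma measurable_prefix_sum n : measurable_fun setT (fun w => \sum_(i < n) k (W i w)).
Proof. by apply: measurable_sum => i; exact: measurableT_comp. Qed.

Lemma iid_Rintegral (h : T1 -> R) i : measurable_fun setT h ->
  \int[P]_w h (W i w) = \int[P]_w h (W0 w).
Proof.
move=> mh; rewrite /Rintegral; congr fine.
apply: (@same_law_integral _ _ _ _ _ _ _ _ (EFin \o h)) => //.
- exact: iW.2.
- exact/measurable_EFinP.
Qed.

Lemma iid_intble (h : T1 -> R) i : measurable_fun setT h ->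
  intble P (fun w => h (W0 w)) -> intble P (fun w => h (W i w)).
Proof.
by move=> mh; apply: same_law_integrable => //; exact: iW.2.
Qed.

Lemma iid_sqint i : sqint P (fun w => k (W0 w)) -> sqint P (fun w => k (W i w)).
Proof.
move=> [_ k2]; split; first exact: measurableT_comp.
by apply: (@iid_intble (fun x => k x ^+ 2)) => //; exact: measurable_funX.
Qed.

(** The cross terms vanish by independence, one new observation at a time. *)
Lemma iid_sum_sqr : sqint P (fun w => k (W0 w)) ->
  \int[P]_w k (W0 w) = 0 -> forall n,
  sqint P (fun w => \sum_(i < n) k (W i w)) /\
  \int[P]_w (\sum_(i < n) k (W i w)) ^+ 2 =
    n%:R * \int[P]_w k (W0 w) ^+ 2.
Proof.
move=> k2 k0; elim => [|n [S2 IH]].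
  under eq_fun do rewrite big_ord0.
  split; first exact: sqint_cst.
  by under eq_Rintegral do rewrite big_ord0 expr0n/=; rewrite Rint_cst mul0r.
have kn2 : sqint P (fun w => k (W n w)) by exact: iid_sqint.
have E w : \sum_(i < n.+1) k (W i w) = \sum_(i < n) k (W i w) + k (W n w).
  by rewrite big_ord_recr.
split; first by under eq_fun do rewrite E; exact: sqintD.
have cross : \int[P]_w ((\sum_(i < n) k (W i w)) * k (W n w)) = 0.
  pose h (x : R * T1) := x.1 * k x.2.
  have mh : measurable_fun setT h.
    by apply: measurable_funM => //; exact: measurableT_comp.
  have [_ ->] := @independent_Rintegral _ _ _ _ _ _ _ _ _ _ h
    (measurable_prefix_sum n) (mW n) (prefix_sum_independent mW n mk iW.1) mh
    (sqint_mul S2 kn2).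
  rewrite -[RHS](Rint_cst P); apply: eq_Rintegral => w _; rewrite /h/=.
  by rewrite RintegralZl ?(@iid_Rintegral k) ?k0 ?mulr0//; exact: sqint_intble.
under eq_Rintegral do rewrite E.
transitivity (\int[P]_w ((\sum_(i < n) k (W i w)) ^+ 2 +
    2 * ((\sum_(i < n) k (W i w)) * k (W n w)) + k (W n w) ^+ 2)).
  by apply: eq_Rintegral => w _; ring.
have i1 := S2.2; have i2 := sqint_mul S2 kn2; have i3 := kn2.2.
rewrite RintegralD//; last exact: intbleD (intbleZ _ i2).
rewrite RintegralD//; last exact: intbleZ.
rewrite RintegralZl// cross mulr0 addr0 IH.
rewrite (@iid_Rintegral (fun x => k x ^+ 2)); last exact: measurable_funX.
by rewrite -natr1 mulrDl mul1r.
Qed.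

End iid_sums.

(** * Test functions with a third-order Taylor expansion *)

Section taylor_class.
Context (R : realType).
Implicit Types (p : R -> R) (C x y h : R).

(** [p1] and [p2] play the role of the first two derivatives of [p], but only the
    Taylor bound links them to [p]: in this form the property passes to averages
    of translates by mere integration of inequalities, without differentiating
    under the integral sign. *)
Record taylor2 (p p1 p2 : R -> R) (C : R) : Prop := Taylor2 {
  tay_ge0 : 0 <= C ;
  tay_bnd : forall x, [/\ `|p x| <= C, `|p1 x| <= C & `|p2 x| <= C] ;
  tay_lip : forall x y, [/\ `|p x - p y| <= C * `|x - y|,
    `|p1 x - p1 y| <= C * `|x - y| & `|p2 x - p2 y| <= C * `|x - y| ] ;
  tay_exp : forall x h,
    `|p (x + h) - p x - p1 x * h - p2 x * h ^+ 2 / 2| <= C * `|h| ^+ 3 }.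

Definition taylor_class p := exists p1 p2 C, taylor2 p p1 p2 C.

Lemma lipschitz_continuous p C : 0 <= C ->
  (forall x y, `|p x - p y| <= C * `|x - y|) -> continuous p.
Proof.
move=> C0 lip x; apply/cvgrPdist_le => e e0.
have C10 : 0 < C + 1 by rewrite ltr_wpDl.
near=> t; rewrite (le_trans (lip _ _))//.
rewrite (@le_trans _ _ ((C + 1) * `|x - t|))//.
  by rewrite ler_wpM2r// lerDl.
rewrite mulrC -ler_pdivlMr//; near: t.
by apply: cvgr_dist_le => //; rewrite divr_gt0.
Unshelve. all: by end_near. Qed.

Lemma taylor_class_cst c : taylor_class (fun=> c).
Proof.
exists (fun=> 0), (fun=> 0), `|c|; split => //.
- by move=> x; rewrite normr0.
- by move=> x y; rewrite !subrr normr0; split; rewrite mulr_ge0.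
- move=> x h; rewrite !mul0r !subr0 subrr normr0.
  by rewrite mulr_ge0// exprn_ge0.
Qed.

Lemma taylor_classD p q : taylor_class p -> taylor_class q ->
  taylor_class (fun x => p x + q x).
Proof.
move=> [p1 [p2 [C [C0 Cb Cl Ce]]]] [q1 [q2 [D [D0 Db Dl De]]]].
exists (fun x => p1 x + q1 x), (fun x => p2 x + q2 x), (C + D); split.
- exact: addr_ge0.
- move=> x; have [a1 a2 a3] := Cb x; have [b1 b2 b3] := Db x.
  by split; rewrite (le_trans (ler_normD _ _))// lerD.
- move=> x y; have [a1 a2 a3] := Cl x y; have [b1 b2 b3] := Dl x y.
  by split; rewrite opprD addrACA (le_trans (ler_normD _ _))// mulrDl lerD.
- move=> x h; rewrite [leRHS]mulrDl (le_trans _ (lerD (Ce x h) (De x h)))//.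
  rewrite (le_trans _ (ler_normD _ _))// le_eqVlt; apply/orP; left.
  by apply/eqP; congr `|_|; ring.
Qed.

Lemma taylor_class_affine p (c a b : R) : taylor_class p ->
  taylor_class (fun x => c * p (a * x + b)).
Proof.
move=> [p1 [p2 [C [C0 Cb Cl Ce]]]].
have a1 : 1 <= 1 + `|a| by rewrite lerDl.
have [B B0 aX] : exists2 B, 0 <= B & forall j, (j <= 3)%N -> `|a| ^+ j <= B.
  exists ((1 + `|a|) ^+ 3); first by rewrite exprn_ge0// (le_trans _ a1).
  move=> j j3; rewrite (@le_trans _ _ ((1 + `|a|) ^+ j))//.
    by rewrite lerXn2r ?nnegrE// ?lerDr// (le_trans _ a1).
  by rewrite ler_weXn2l.
pose A := `|c| * (B * C).
have A0 : 0 <= A by rewrite !mulr_ge0.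
have K (j : nat) (u v : R) : (j <= 3)%N -> 0 <= v ->
    `|u| <= C * v -> `|c * (a ^+ j * u)| <= A * v.
  move=> j3 v0 uCv; rewrite !normrM normrX /A -!mulrA ler_wpM2l//.
  by rewrite ler_pM ?exprn_ge0//; exact: aX.
exists (fun x => c * (a * p1 (a * x + b))),
  (fun x => c * (a ^+ 2 * p2 (a * x + b))), A; split => //.
- move=> x; have [a1' a2' a3'] := Cb (a * x + b); split; rewrite -[A]mulr1.
  + by have := K 0%N (p (a * x + b)) 1; rewrite expr0 mul1r mulr1; apply.
  + by have := K 1%N (p1 (a * x + b)) 1; rewrite expr1 mulr1; apply.
  + by have := K 2%N (p2 (a * x + b)) 1; rewrite mulr1; apply.
- move=> x y; have [a1' a2' a3'] := Cl (a * x + b) (a * y + b).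
  have E : `|a * x + b - (a * y + b)| = `|a| * `|x - y|.
    by rewrite -normrM; congr `|_|; ring.
  rewrite !E in a1' a2' a3'.
  have K' (j : nat) (u : R) : (j <= 2)%N -> `|u| <= C * (`|a| * `|x - y|) ->
      `|c * (a ^+ j * u)| <= A * `|x - y|.
    move=> j2 uC; rewrite !normrM normrX /A -!mulrA ler_wpM2l//.
    rewrite (@le_trans _ _ (`|a| ^+ j * (C * (`|a| * `|x - y|))))//.
      by rewrite ler_wpM2l// exprn_ge0.
    rewrite [leLHS](_ : _ = `|a| ^+ j.+1 * (C * `|x - y|)); last by rewrite exprS; ring.
    by rewrite ler_wpM2r ?mulr_ge0//; apply: (aX j.+1).
  split.
  + by have := @K' 0%N _ isT a1'; rewrite expr0 mul1r mulrBr.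
  + by have := @K' 1%N _ isT a2'; rewrite expr1 !mulrBr.
  + by have := @K' 2%N _ isT a3'; rewrite !mulrBr.
- move=> x h; have := Ce (a * x + b) (a * h).
  have -> : a * x + b + a * h = a * (x + h) + b by ring.
  rewrite [`|a * h|]normrM [(_ * `|h|) ^+ 3]exprMn => H.
  rewrite [X in `|X|](_ : _ = c * (p (a * (x + h) + b) - p (a * x + b) -
    p1 (a * x + b) * (a * h) - p2 (a * x + b) * (a * h) ^+ 2 / 2)); last by ring.
  rewrite normrM /A -(mulrA `|c|) ler_wpM2l// (le_trans H)// mulrCA mulrA.
  by rewrite ler_wpM2r ?exprn_ge0// ler_wpM2r//; apply: (aX 3%N).
Qed.

Definition pos_part x := Num.max x 0.
Lemma pos_part_ge0 x : 0 <= x -> pos_part x = x. Proof. by move=> x0; exact/max_idPl. Qed.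
Lemma pos_part_le0 x : x <= 0 -> pos_part x = 0. Proof. by move=> x0; exact/max_idPr. Qed.

(** A third difference: it vanishes on polynomials of degree at most 2, so it turns
    truncated powers into splines that are constant outside of a segment. *)
Definition diff3 (u : R -> R) x := u x - 3 * u (x - 1) + 3 * u (x - 2) - u (x - 3).

(** A cubic spline that climbs from 0 on the left of 0 to 1 on the right of 3;
    [step1] and [step2] are its first two derivatives. *)
Definition step0 x := diff3 (fun x => pos_part x ^+ 3) x / 6.
Definition step1 x := diff3 (fun x => pos_part x ^+ 2) x / 2.
Definition step2 x := diff3 pos_part x.

Variant pos_part_spec x : R -> R -> R -> R -> Prop :=
| PP0 of x <= 0 : pos_part_spec x 0 0 0 0
| PP1 of 0 <= x & x <= 1 : pos_part_spec x x 0 0 0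
| PP2 of 1 <= x & x <= 2 : pos_part_spec x x (x - 1) 0 0
| PP3 of 2 <= x & x <= 3 : pos_part_spec x x (x - 1) (x - 2) 0
| PP4 of 3 <= x : pos_part_spec x x (x - 1) (x - 2) (x - 3).

Lemma pos_partP x : pos_part_spec x (pos_part x) (pos_part (x - 1))
  (pos_part (x - 2)) (pos_part (x - 3)).
Proof.
have [x0|x0] := leP x 0.
  by rewrite !pos_part_le0; [constructor|lra..].
have [x1|x1] := leP x 1.
  by rewrite (@pos_part_ge0 x) ?(@pos_part_le0 (x - _)); [constructor; lra|lra..].
have [x2|x2] := leP x 2.
  by rewrite (@pos_part_ge0 x) ?(@pos_part_ge0 (x - 1)) ?(@pos_part_le0 (x - _));
    [constructor; lra|lra..].
have [x3|x3] := leP x 3.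
  by rewrite (@pos_part_ge0 x) ?(@pos_part_ge0 (x - 1)) ?(@pos_part_ge0 (x - 2))
    ?(@pos_part_le0 (x - _));
    [constructor; lra|lra..].
by rewrite !pos_part_ge0; [constructor; lra|lra..].
Qed.

Lemma step0_bnd x : 0 <= step0 x <= 1.
Proof.
rewrite /step0/diff3; case: (pos_partP x) => [|x0 x1|x1 x2|x2 x3|].
- lra.
- have : 0 <= x ^+ 3 <= 1 by rewrite exprn_ge0//= exprn_ile1.
  by lra.
- have [t tE] : exists t, t = x - 1 by exists (x - 1).
  have -> : x = t + 1 by lra.
  have t01 : 0 <= t <= 1 by lra.
  have : 0 <= t ^+ 3 <= 1 by rewrite exprn_ge0 ?exprn_ile1//; lra.
  have : 0 <= t ^+ 2 <= 1 by rewrite exprn_ge0 ?exprn_ile1//; lra.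
  have : t ^+ 3 <= t ^+ 2 by rewrite ler_wiXn2l//; lra.
  have : 0 <= (1 - t) ^+ 2 * (1 + 2 * t) by rewrite mulr_ge0 ?sqr_ge0//; lra.
  rewrite (_ : (1 - t) ^+ 2 * (1 + 2 * t) = 2 * t ^+ 3 - 3 * t ^+ 2 + 1); last by ring.
  rewrite (_ : _ - _ + _ - _ = - 2 * t ^+ 3 + 3 * t ^+ 2 + 3 * t + 1); last by ring.
  by lra.
- have [t tE] : exists t, t = 3 - x by exists (3 - x).
  have -> : x = 3 - t by lra.
  have t01 : 0 <= t <= 1 by lra.
  have : 0 <= t ^+ 3 <= 1 by rewrite exprn_ge0 ?exprn_ile1//; lra.
  rewrite (_ : _ - _ + _ - _ = 6 - t ^+ 3); last by ring.
  by lra.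
- move=> x3; rewrite (_ : _ - _ + _ - _ = 6); last by ring.
  by lra.
Qed.

Lemma step0_le0 x : x <= 0 -> step0 x = 0.
Proof. by move=> x0; rewrite /step0/diff3 !pos_part_le0; [ring|lra..]. Qed.

Lemma step0_ge3 x : 3 <= x -> step0 x = 1.
Proof. by move=> x3; rewrite /step0/diff3 !pos_part_ge0; [field|lra..]. Qed.

Lemma step1_bnd x : `|step1 x| <= 8.
Proof.
by rewrite ler_norml /step1/diff3; case: (pos_partP x) => *; nra.
Qed.

Lemma step2_bnd x : `|step2 x| <= 8.
Proof.
by rewrite ler_norml /step2/diff3; case: (pos_partP x) => *; nra.
Qed.

Lemma pos_part_lip x y : `|pos_part x - pos_part y| <= `|x - y|.
Proof.
have [x0|x0] := leP x 0; have [y0|y0] := leP y 0; rewrite ?(pos_part_le0 x0)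
  ?(pos_part_le0 y0) ?(pos_part_ge0 (ltW x0)) ?(pos_part_ge0 (ltW y0)) //.
- by rewrite subrr normr0.
- by rewrite sub0r normrN distrC !gtr0_norm//; lra.
- by rewrite subr0 !gtr0_norm//; lra.
Qed.

Lemma pos_part_sqr_exp x h :
  `|pos_part (x + h) ^+ 2 - pos_part x ^+ 2 - 2 * pos_part x * h| <= h ^+ 2.
Proof.
have [x0|x0] := leP x 0; have [y0|y0] := leP (x + h) 0; rewrite ?(pos_part_le0 x0)
  ?(pos_part_le0 y0) ?(pos_part_ge0 (ltW x0)) ?(pos_part_ge0 (ltW y0)) ler_norml;
  have hh := sqr_ge0 h; apply/andP; split.
- by lra.
- by lra.
- by have := sqr_ge0 (x + h); lra.
- have : 0 <= (- x) * (x + h + h) by rewrite mulr_ge0; lra.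
  by nra.
- have : 0 <= x * - (x + h + h) by rewrite mulr_ge0; lra.
  by nra.
- have := sqr_ge0 (x + h).
  by nra.
- by nra.
- by nra.
Qed.

(** The remainder is 0 or [h ^+ 3] if [x] and [x + h] are on the same side of 0.
    Otherwise it is [(x + h) ^+ 3] or [h ^+ 3 - (x + h) ^+ 3], where [x + h] has the
    sign of [h] and is not larger in absolute value. *)
Lemma pos_part_cub_exp x h :
  `|pos_part (x + h) ^+ 3 - pos_part x ^+ 3 - 3 * pos_part x ^+ 2 * h - 3 * pos_part x * h ^+ 2|
  <= `|h| ^+ 3.
Proof.
have [x0|x0] := leP x 0; have [y0|y0] := leP (x + h) 0; rewrite ?(pos_part_le0 x0)
  ?(pos_part_le0 y0) ?(pos_part_ge0 (ltW x0)) ?(pos_part_ge0 (ltW y0)).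
- by rewrite [X in `|X|](_ : _ = 0) ?normr0 ?exprn_ge0//; ring.
- have h0 : 0 <= h by lra.
  have y3 : (x + h) ^+ 3 <= h ^+ 3 by rewrite lerXn2r ?nnegrE//; lra.
  have y30 := exprn_ge0 3 (ltW y0).
  by rewrite (ger0_norm h0) ger0_norm; lra.
- have h0 : h <= 0 by lra.
  have [t ht] : exists t, t = - (x + h) by exists (- (x + h)).
  have t0 : 0 <= t by lra.
  have -> : h = - (x + t) by lra.
  rewrite normrN (ger0_norm (_ : 0 <= x + t)); last by lra.
  have t3 : 0 <= t ^+ 3 by exact: exprn_ge0.
  have x3 : 0 <= x ^+ 3 by rewrite exprn_ge0// ltW.
  have xt : 0 <= x * t by rewrite mulr_ge0// ltW.
  have xt1 : 0 <= x * t * x by rewrite mulr_ge0// ltW.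
  have xt2 : 0 <= x * t * t by rewrite mulr_ge0.
  rewrite ler_norml; apply/andP; split; rewrite -subr_ge0.
    rewrite [leRHS](_ : _ = t ^+ 3); [done|ring].
  rewrite [leRHS](_ : _ = 2 * x ^+ 3 + 6 * (x * t * x) + 6 * (x * t * t) + t ^+ 3); [lra|ring].
- by rewrite [X in `|X|](_ : _ = h ^+ 3) ?normrX//; ring.
Qed.

Lemma diff3_le (u v : R -> R) (D : R) x y :
  (forall c, `|u (x - c) - v (y - c)| <= D) -> `|diff3 u x - diff3 v y| <= 8 * D.
Proof.
move=> H.
have /ler_normlP[a1 a2] : `|u x - v y| <= D by have := H 0; rewrite !subr0.
have /ler_normlP[b1 b2] := H 1; have /ler_normlP[c1 c2] := H 2.
have /ler_normlP[d1 d2] := H 3.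
by rewrite /diff3 ler_norml; apply/andP; split; lra.
Qed.

(** The Taylor bound is inherited from the truncated cube.  The Lipschitz bounds on
    [step0] and [step1] then follow from their own expansions for increments at
    most 1, and from boundedness for larger ones. *)
Lemma taylor_class_step : taylor_class step0.
Proof.
exists step1, step2, 36.
have bnd0 x : `|step0 x| <= 8.
  by have := step0_bnd x => /andP[s0 s1]; rewrite ger0_norm; lra.
have e0 x h : `|step0 (x + h) - step0 x - step1 x * h - step2 x * h ^+ 2 / 2|
    <= 8 / 6 * `|h| ^+ 3.
  pose v y := pos_part y ^+ 3 + 3 * pos_part y ^+ 2 * h + 3 * pos_part y * h ^+ 2.
  rewrite [X in `|X|](_ : _ = (diff3 (fun x => pos_part x ^+ 3) (x + h) - diff3 v x) / 6);
    last by rewrite /step0/step1/step2/diff3/v; field.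
  rewrite normrM [X in _ * X]ger0_norm// mulrAC ler_wpM2r//.
  apply: diff3_le => c; rewrite /v addrAC.
  by have := pos_part_cub_exp (x - c) h; rewrite !opprD !addrA.
have e1 x h : `|step1 (x + h) - step1 x - step2 x * h| <= 4 * h ^+ 2.
  pose v y := pos_part y ^+ 2 + 2 * pos_part y * h.
  rewrite [X in `|X|](_ : _ = (diff3 (fun x => pos_part x ^+ 2) (x + h) - diff3 v x) / 2);
    last by rewrite /step1/step2/diff3/v; field.
  rewrite normrM [X in _ * X]ger0_norm// ler_pdivrMr//.
  rewrite [leRHS](_ : _ = 8 * h ^+ 2); last by ring.
  apply: diff3_le => c; rewrite /v addrAC.
  by have := pos_part_sqr_exp (x - c) h; rewrite !opprD !addrA.
have l2 x y : `|step2 x - step2 y| <= 8 * `|x - y|.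
  apply: diff3_le => c; have := pos_part_lip (x - c) (y - c).
  by rewrite opprB addrA subrK.
have l1 x y : `|step1 x - step1 y| <= 16 * `|x - y|.
  have [h ->] : exists h, x = y + h by exists (x - y); ring.
  rewrite (addrC y) addrK addrC.
  have /ler_normlP[b1 b2] := step1_bnd (y + h).
  have /ler_normlP[b3 b4] := step1_bnd y.
  have [h1|h1] := leP 1 `|h|; first by rewrite ler_norml; apply/andP; split; lra.
  have /ler_normlP[c1 c2] := e1 y h.
  have : `|step2 y * h| <= 8 * `|h| by rewrite normrM ler_wpM2r// step2_bnd.
  move=> /ler_normlP[d1 d2].
  have : h ^+ 2 <= `|h| by rewrite -real_normK ?num_real// expr2 ler_piMl// ltW.
  by move=> hh; rewrite ler_norml; apply/andP; split; lra.
have l0 x y : `|step0 x - step0 y| <= 36 * `|x - y|.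
  have [h ->] : exists h, x = y + h by exists (x - y); ring.
  rewrite (addrC y) addrK addrC.
  have /ler_normlP[b1 b2] := bnd0 (y + h).
  have /ler_normlP[b3 b4] := bnd0 y.
  have [h1|h1] := leP 1 `|h|; first by rewrite ler_norml; apply/andP; split; lra.
  have /ler_normlP[c1 c2] := e0 y h.
  have : `|step1 y * h| <= 8 * `|h| by rewrite normrM ler_wpM2r// step1_bnd.
  move=> /ler_normlP[d1 d2].
  have : `|step2 y * h ^+ 2| <= 8 * `|h| ^+ 2.
    by rewrite normrM normrX ler_wpM2r ?exprn_ge0// step2_bnd.
  move=> /ler_normlP[f1 f2].
  have h2 : `|h| ^+ 2 <= `|h| by rewrite expr2 ler_piMl// ltW.
  have h3 : `|h| ^+ 3 <= `|h|.
    by rewrite exprS ler_piMr// exprn_ile1// ltW.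
  by rewrite ler_norml; apply/andP; split; lra.
split => //.
- move=> x; have := bnd0 x; have := step1_bnd x; have := step2_bnd x.
  by move=> *; split; lra.
- move=> x y; have := l0 x y; have := l1 x y; have := l2 x y.
  by have := normr_ge0 (x - y); move=> *; split; lra.
- move=> x h; rewrite (le_trans (e0 x h))// ler_wpM2r ?exprn_ge0//.
  by lra.
Qed.

Lemma continuous_uniform (g : R -> R) (A e : R) : continuous g -> 0 < e ->
  exists2 dl, 0 < dl & forall x y, `|x| <= A -> `|x - y| <= dl ->
    `|g x - g y| <= e.
Proof.
move=> cg e0.
have : compact `[-A, A]%classic by exact: segment_compact.
move=> /compact_near_coveringP/(_ R (0^'+)
  (fun dl x => forall y, `|x - y| <= dl -> `|g x - g y| <= e) _).
case => [x xA|].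
  have /cvgrPdist_lt/(_ (e / 2)) := cg x; rewrite divr_gt0// => /(_ isT).
  move=> [r /= r0 H].
  exists (ball x (r / 2), [set dl | dl < r / 2]) => /=.
    split; first by apply: nbhsx_ballx; rewrite divr_gt0.
    by apply: nbhs_right_lt; rewrite divr_gt0.
  move=> [z dl] /= [xz dlr] y zy.
  have gz : `|g x - g z| < e / 2 by apply: H; rewrite /= (lt_le_trans xz)//; lra.
  have gy : `|g x - g y| < e / 2.
    apply: H => /=; rewrite -[x](subrK z) -addrA (le_lt_trans (ler_normD _ _))//.
    by rewrite /ball/= in xz; lra.
  rewrite -[g z](subrK (g x)) -addrA (le_trans (ler_normD _ _))//.
  by rewrite distrC; lra.
move=> d d0 H.
rewrite /= in d0; exists (d / 2); first by rewrite divr_gt0.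
move=> x y xA xy; apply: (H (d / 2)) => //=.
- have d20 : 0 < d / 2 by rewrite divr_gt0. 
  by rewrite sub0r normrN gtr0_norm; lra.
- by rewrite divr_gt0.
- by rewrite in_itv/= -ler_norml.
Qed.

(** Interpolate [g] by smooth steps on a grid finer than its modulus of continuity
    on [-A, A].  At each point a single step is in transition, so the
    interpolant is a convex combination of two neighboring values of [g]. *)
Lemma taylor_approx (g : R -> R) (M A e : R) : continuous g ->
  (forall x, `|g x| <= M) -> 0 < A -> 0 < e ->
  exists p, [/\ taylor_class p, forall x, `|p x| <= M &
    forall x, `|x| <= A -> `|g x - p x| <= e].
Proof.
move=> cg gM A0 e0.
have e20 : 0 < e / 2 by rewrite divr_gt0.
have [dl dl0 gdl] := continuous_uniform A cg e20.
pose xk (k : nat) : R := - A + k%:R * dl.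
pose p (n : nat) x := g (xk 0%N) +
  \sum_(k < n) (g (xk k.+1) - g (xk k)) * step0 (3 / dl * x + - (3 / dl * xk k)).
have xkS k : xk k.+1 = xk k + dl by rewrite /xk -natr1; ring.
have dl3 : 0 < 3 / dl by rewrite divr_gt0.
have pS n x : p n.+1 x = p n x +
    (g (xk n.+1) - g (xk n)) * step0 (3 / dl * x + - (3 / dl * xk n)).
  by rewrite /p big_ord_recr addrA.
have sle n x : x <= xk n -> step0 (3 / dl * x + - (3 / dl * xk n)) = 0.
  by move=> xn; rewrite step0_le0// subr_le0 ler_wpM2l// ltW.
have sge n x : xk n.+1 <= x -> step0 (3 / dl * x + - (3 / dl * xk n)) = 1.
  move=> xn; rewrite step0_ge3// -mulrBr.
  rewrite (@le_trans _ _ (3 / dl * dl))//; first by rewrite divfK// gt_eqF.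
  by rewrite ler_wpM2l ?(ltW dl3)//; rewrite xkS in xn; lra.
have main n : [/\ taylor_class (p n),
    forall x, xk n <= x -> p n x = g (xk n),
    forall x, `|p n x| <= M &
    forall x, `|x| <= A -> x <= xk n -> `|g x - p n x| <= e].
  elim: n => [|n [IH0 IH1 IH2 IH3]].
    have p0 x : p 0%N x = g (xk 0%N) by rewrite /p big_ord0 addr0.
    split => [|x _|x|x xA x0]; rewrite ?p0//.
      rewrite (_ : p 0%N = fun=> g (xk 0%N)); first exact: taylor_class_cst.
      by apply/funext => x; rewrite p0.
    rewrite (_ : x = xk 0%N) ?subrr ?normr0 ?ltW//.
    apply/eqP; rewrite eq_le x0 /=; move: xA; rewrite ler_norml => /andP[+ _].
    by rewrite /xk mul0r addr0.
  (* on [xk n, xk (n + 1)] the value is a convex combination *)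
  have conv x : xk n <= x -> exists2 t, 0 <= t <= 1 &
      p n.+1 x = (1 - t) * g (xk n) + t * g (xk n.+1).
    move=> nx; exists (step0 (3 / dl * x + - (3 / dl * xk n))).
      exact: step0_bnd.
    by rewrite pS IH1//; ring.
  split.
  - rewrite (_ : p n.+1 = fun x => p n x +
      (g (xk n.+1) - g (xk n)) * step0 (3 / dl * x + - (3 / dl * xk n))).
      by apply: taylor_classD => //; apply: taylor_class_affine taylor_class_step.
    by apply/funext => x; rewrite pS.
  - move=> x xn; rewrite pS sge// IH1; first by ring.
    by rewrite (le_trans _ xn)// xkS lerDl ltW.
  - move=> x; have [xn|/ltW nx] := leP x (xk n).
      by rewrite pS sle// mulr0 addr0.
    have [t /andP[t0 t1] ->] := conv _ nx.
    have := gM (xk n); have := gM (xk n.+1).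
    rewrite !ler_norml => /andP[a1 a2] /andP[b1 b2].
    by apply/andP; split; nra.
  - move=> x xA xn1; have [xn|/ltW nx] := leP x (xk n).
      by rewrite pS sle// mulr0 addr0; exact: IH3.
    have [t /andP[t0 t1] ->] := conv _ nx.
    have : `|g x - g (xk n)| <= e / 2.
      by apply: gdl => //; rewrite ger0_norm; rewrite xkS in xn1; lra.
    have : `|g x - g (xk n.+1)| <= e / 2.
      by apply: gdl => //; rewrite ler0_norm; rewrite xkS in xn1 *; lra.
    rewrite !ler_norml => /andP[a1 a2] /andP[b1 b2].
    by apply/andP; split; nra.
pose n := (Num.trunc (2 * A / dl)).+1.
have [t1 _ t2 t3] := main n.
exists (p n); split => // x xA; apply: t3 => //.
have : 2 * A / dl < n%:R by apply: truncnS_gt.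
rewrite ltr_pdivrMr// /xk => H.
by move: xA; rewrite ler_norml => /andP[]; lra.
Qed.

(** A smooth majorant of the indicator of [K + 3 <= |x|] that vanishes on
    [|x| <= K], whose integral controls the mass of the tails. *)
Definition tail_step (K x : R) := step0 (x - K) + step0 (- x - K).

Lemma taylor_class_tail K : taylor_class (tail_step K).
Proof.
have h1 := taylor_class_affine 1 1 (- K) taylor_class_step.
have h2 := taylor_class_affine 1 (-1) (- K) taylor_class_step.
have := taylor_classD h1 h2; rewrite /tail_step.
by under eq_fun do rewrite !mul1r mulN1r.
Qed.

Lemma tail_step_bnd K x : 0 <= tail_step K x <= 2.
Proof.
rewrite /tail_step; have := step0_bnd (x - K); have := step0_bnd (- x - K); lra.
Qed.

Lemma tail_step0 K x : `|x| <= K -> tail_step K x = 0.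
Proof.
by rewrite ler_norml => /andP[a b]; rewrite /tail_step !step0_le0 ?addr0//; lra.
Qed.

Lemma tail_step_ge1 K x : K + 3 <= `|x| -> 1 <= tail_step K x.
Proof.
rewrite /tail_step; have := step0_bnd (x - K); have := step0_bnd (- x - K).
move=> /andP[b1 b2] /andP[b3 b4]; have [x0|x0] := ger0P x => Kx.
  by rewrite (@step0_ge3 (x - K)); lra.
by rewrite (@step0_ge3 (- x - K)); lra.
Qed.

Lemma taylor_class_measurable p : taylor_class p -> measurable_fun setT p.
Proof.
move=> [p1 [p2 [C [C0 _ lip _]]]]; apply: continuous_measurable_fun.
by apply: (lipschitz_continuous C0) => x y; have [] := lip x y.
Qed.

End taylor_class.

(** * Convergence in distribution from smooth test functions *)

Section portmanteau.
Context d (T : measurableType d) (R : realType) (P : probability T R).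
Context (mu : probability (measurableTypeR R) R).
Variables (U : nat -> T -> R) (mU : forall n, measurable_fun setT (U n)).

Lemma tail_step_cvg0 :
  (\int[mu]_x tail_step K%:R x) @[K --> \oo] --> (0 : R).
Proof.
have mt K : measurable_fun [set: measurableTypeR R] (EFin \o tail_step K).
  by apply/measurable_EFinP; exact: taylor_class_measurable (taylor_class_tail K).
have := @dominated_cvg _ _ _ mu setT measurableT
  (fun K => EFin \o tail_step K%:R) (cst 0%E) (cst 2%:E).
move=> /(_ (fun K => mt _)).
have h1 (x : R) : setT x -> (EFin \o tail_step K%:R) x @[K --> \oo] --> 0%E.
  move=> _; apply: cvg_near_cst; near=> K.
  rewrite /= tail_step0//; near: K; exact: nbhs_infty_ger.
move=> /(_ h1 (fun _ _ => erefl) (intble_cst mu 2)).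
have h2 (K : nat) (x : R) : setT x -> (`|(EFin \o tail_step K%:R) x| <= 2%:E)%E.
  move=> _; rewrite /= lee_fin; have /andP[a b] := tail_step_bnd K%:R x.
  by rewrite ger0_norm.
move=> /(_ h2); rewrite integral0 => H.
exact: (@fine_cvg _ _ _ _ _ (0 : R) H).
Unshelve. all: by end_near. Qed.

(** Outside of [|x| <= K + 3] the error between [g] and its approximation is at most
    [2 * M * tail_step K x]; convergence for the test function [tail_step K] bounds
    the mass of this tail uniformly in [n]. *)
Lemma cvg_in_distribution_taylor :
  (forall p, taylor_class p ->
     (\int[P]_w p (U n w)) @[n --> \oo] --> \int[mu]_x p x) ->
  cvg_in_distribution P U mu.
Proof.
move=> H g cg [M gM].
have M0 : 0 <= M by apply: le_trans (gM 0).
have mg : measurable_fun setT g by exact: continuous_measurable_fun.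
have iU (q : R -> R) (Q : R) n : measurable_fun setT q -> (forall x, `|q x| <= Q) ->
    intble P (fun w => q (U n w)).
  by move=> mq qQ; apply: (@intble_bounded _ _ _ _ _ Q) => //; exact: measurableT_comp.
have imu (q : R -> R) (Q : R) : measurable_fun setT q -> (forall x, `|q x| <= Q) -> intble mu q.
  by move=> mq qQ; apply: (@intble_bounded _ _ _ _ _ Q).
suff E : (\int[P]_w g (U n w)) @[n --> \oo] --> \int[mu]_x g x.
  have -> : (fun n => 'E_P[g \o U n])%E = (fun n => (\int[P]_w g (U n w))%:E).
    apply/funext => n; rewrite unlock fineK//.
    by apply: integrable_fin_num => //; exact: iU gM.
  have -> : (\int[mu]_x (g x)%:E)%E = (\int[mu]_x g x)%:E.
    by rewrite fineK//; apply: integrable_fin_num => //; exact: imu gM.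
  by apply/fine_cvgP; split; [exact: nearW|exact: E].
apply/cvgrPdist_le => e e0.
(* a tail of mass at most [e1] costs at most [2 * M * e1 <= e / 4] *)
pose e1 := e / (8 * (M + 1)).
have M1 : 0 < M + 1 by lra.
have e10 : 0 < e1 by rewrite divr_gt0// mulr_gt0.
have [K tK] : exists K : nat, `|\int[mu]_x tail_step K%:R x| <= e1 / 2.
  have /cvgrPdist_le/(_ (e1 / 2)) := tail_step_cvg0.
  rewrite divr_gt0// => /(_ isT) [K _ /(_ K)/= Kh]; exists K.
  by rewrite -normrN -sub0r; apply: Kh.
have [p [tp pM pg]] : exists p, [/\ taylor_class p, forall x, `|p x| <= M &
    forall x, `|x| <= K%:R + 3 -> `|g x - p x| <= e / 8].
  by apply: taylor_approx => //; rewrite ?divr_gt0// ltr_wpDl.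
have mp := taylor_class_measurable tp.
pose tau := tail_step (K%:R : R).
have mtau : measurable_fun setT tau := taylor_class_measurable (taylor_class_tail _).
have tau2 x : `|tau x| <= 2.
  by have /andP[a b] := tail_step_bnd K%:R x; rewrite ger0_norm.
have gp x : `|g x - p x| <= e / 8 + 2 * M * tau x.
  have /andP[t0 t2] := tail_step_bnd K%:R x.
  have [xK|/ltW xK] := leP `|x| (K%:R + 3).
    by rewrite (le_trans (pg _ xK))// lerDl !mulr_ge0.
  have t1 := tail_step_ge1 xK.
  have := gM x; have := pM x; rewrite !ler_norml -/tau => /andP[a1 a2] /andP[b1 b2].
  have : 2 * M <= 2 * M * tau x by rewrite ler_peMr ?mulr_ge0.
  by move=> ?; apply/andP; split; lra.
have diffP n : `|\int[P]_w g (U n w) - \int[P]_w p (U n w)| <=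
    e / 8 + 2 * M * \int[P]_w tau (U n w).
  have it := iU _ _ n mtau tau2.
  rewrite (@le_trans _ _ (\int[P]_w (e / 8 + 2 * M * tau (U n w))))//.
    apply: Rint_dist => //; [exact: iU gM|exact: iU pM|].
    exact: intbleD (intble_cst _ _) (intbleZ _ it).
  rewrite RintegralD//; [|exact: intble_cst|exact: intbleZ].
  by rewrite Rint_cst RintegralZl.
have diffmu : `|\int[mu]_x g x - \int[mu]_x p x| <=
    e / 8 + 2 * M * \int[mu]_x tau x.
  have it := imu _ _ mtau tau2.
  rewrite (@le_trans _ _ (\int[mu]_x (e / 8 + 2 * M * tau x)))//.
    apply: Rint_dist => //; [exact: imu gM|exact: imu pM|].
    exact: intbleD (intble_cst _ _) (intbleZ _ it).
  rewrite RintegralD//; [|exact: intble_cst|exact: intbleZ].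
  by rewrite Rint_cst RintegralZl.
have /cvgrPdist_le/(_ (e / 8)) cp := H _ tp.
have /cvgrPdist_le/(_ (e1 / 2)) ct := H _ (taylor_class_tail K%:R).
have e80 : 0 < e / 8 by rewrite divr_gt0.
have e120 : 0 < e1 / 2 by rewrite divr_gt0.
have Me : (M + 1) * e1 = e / 8 by rewrite /e1; field; rewrite gt_eqF.
near=> n.
have cpn : `|\int[mu]_x p x - \int[P]_w p (U n w)| <= e / 8 by near: n; exact: cp.
have ctn : `|\int[mu]_x tau x - \int[P]_w tau (U n w)| <= e1 / 2.
  by near: n; exact: ct.
have tP : 2 * M * \int[P]_w tau (U n w) <= 2 * M * e1.
  by rewrite ler_wpM2l ?mulr_ge0//; move: tK ctn => /ler_normlP[_ h1] /ler_normlP[h2 _]; lra.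
have tmu : 2 * M * \int[mu]_x tau x <= 2 * M * (e1 / 2).
  by rewrite ler_wpM2l ?mulr_ge0//; case/ler_normlP: tK.
rewrite (le_trans (ler_distD (\int[mu]_x p x) _ _))//.
rewrite (le_trans (lerD diffmu (ler_distD (\int[P]_w p (U n w)) _ _)))//.
rewrite [X in _ + (_ + X)]distrC.
rewrite (le_trans (lerD (lexx _) (lerD cpn (diffP n))))//.
by clear diffmu cpn ctn tK; lra.
Unshelve. all: by end_near. Qed.

End portmanteau.

(** * Convolution of Gaussian laws *)

Section gaussian.
Context (R : realType).
Local Notation lam := (@lebesgue_measure R).
Local Notation N01 := (normal_prob (0 : R) 1).

(** The Radon-Nikodym derivative of the Gaussian law is its density almost everywhere. *)
Lemma ge0_integral_normal_prob (m s : R) (f : R -> \bar R) :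
  measurable_fun setT f -> (forall x, 0 <= f x)%E ->
  (\int[normal_prob m s]_x f x = \int[lam]_x (f x * (normal_pdf m s x)%:E))%E.
Proof.
move=> mf f0.
have dom := normal_prob_dominates m s.
rewrite -(Radon_Nikodym_SigmaFinite.change_of_variables dom)//.
have iRN := Radon_Nikodym_SigmaFinite.f_integrable dom.
have mpdf : measurable_fun setT (fun x => (normal_pdf m s x)%:E).
  by apply/measurable_EFinP; exact: measurable_normal_pdf.
apply: ae_eq_integral => //.
- by apply: emeasurable_funM => //; exact: measurable_int iRN.
- exact: emeasurable_funM.
- apply: ae_eqe_mul2l; apply: integral_ae_eq => // E _ mE.
  by rewrite -Radon_Nikodym_SigmaFinite.f_integral.
Qed.

Lemma normal_pdf_peak1E (m s x : R) : 0 < s ->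
  normal_pdf m s x = normal_peak 1 / s * expR (- (x - m) ^+ 2 / (2 * s ^+ 2)).
Proof.
move=> s0; rewrite normal_pdfE ?gt_eqF//; congr (_ * expR (_ / _)).
  rewrite /normal_peak expr1n mul1r -mulrnAr sqrtrM ?sqr_ge0//.
  by rewrite sqrtr_sqr gtr0_norm// invfM mulrC.
by rewrite mulr_natl.
Qed.

Lemma normal_pdf_scale (x a y : R) : 0 < a ->
  normal_pdf x a (x + a * y) * a = normal_pdf 0 1 y.
Proof.
move=> a0; rewrite !normal_pdf_peak1E// mulrAC invr1 mulr1 divfK ?gt_eqF//.
by congr (_ * expR _); field; rewrite gt_eqF.
Qed.

(** Completing the square in [z]. *)
Lemma normal_pdf_convolution (x a b c u z : R) : 0 < a -> 0 < b -> 0 < c ->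
  c ^+ 2 = a ^+ 2 + b ^+ 2 ->
  normal_pdf (x + b * z) a u * normal_pdf 0 1 z =
  normal_pdf x c u * normal_pdf (b * (u - x) / c ^+ 2) (a / c) z.
Proof.
move=> a0 b0 c0 cE; rewrite !normal_pdf_peak1E// ?divr_gt0//.
have a1 : a != 0 by rewrite gt_eqF.
have c1 : c != 0 by rewrite gt_eqF.
rewrite mulrACA -expRD [RHS]mulrACA -expRD; congr (_ * expR _).
  by field; rewrite a1 c1.
have c2 : a ^+ 2 + b ^+ 2 != 0 by rewrite -cE expf_neq0.
rewrite !exprMn !exprVn cE; field.
by rewrite c2 a1.
Qed.

(** Substitution [u = x + a * y]. *)
Lemma ge0_integral_normal_affine (g : R -> R) (x a : R) : 0 < a ->
  continuous g -> (forall y, 0 <= g y) ->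
  (\int[N01]_y (g (x + a * y))%:E =
   \int[lam]_u ((g u)%:E * (normal_pdf x a u)%:E))%E.
Proof.
move=> a0 cg g0.
pose G u := g u * normal_pdf x a u.
have cF : continuous (fun y : R => x + a * y).
  move=> y; apply: (@cvgD _ R^o); first exact: cvg_cst.
  by apply: (@cvgM R); [exact: cvg_cst|exact: cvg_id].
have F'E : derive1 (fun y : R => x + a * y) = cst a.
  apply/funext => y; rewrite derive1E deriveD// derive_cst add0r.
  by rewrite deriveM// derive_cst scaler0 addr0 derive_id /GRing.scale/= mulr1.
rewrite ge0_integral_normal_prob; last 2 first.
- apply/measurable_EFinP; apply: continuous_measurable_fun.
  by move=> y; apply: continuous_comp; [exact: cF|exact: cg].
- by move=> y; rewrite lee_fin.
transitivity (\int[lam]_u (G u)%:E)%E; last first.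
  by apply: eq_integral => u _; rewrite EFinM.
rewrite (@increasing_ge0_integration_by_substitutionT _
    (fun y : R => x + a * y) G).
- apply: eq_integral => y _; rewrite -EFinM; congr EFin.
  by rewrite F'E /G /= -(normal_pdf_scale x y a0) mulrA.
- by move=> y z yz; rewrite ltrD2l ltr_pM2l.
- by rewrite F'E => ?; exact: cvg_cst.
- by rewrite F'E; exact: is_cvg_cst.
- by rewrite F'E; exact: is_cvg_cst.
- by [].
- exact: cvg_comp (gt0_cvgMrNy a0 cvg_id) (cvg_addrl_Ny x).
- exact: cvg_comp (gt0_cvgMry a0 cvg_id) (cvg_addrl x).
- move=> y; apply: cvgM; first exact: cg.
  by apply: continuous_normal_pdf; rewrite gt_eqF.
- by move=> y; rewrite mulr_ge0 ?normal_pdf_ge0.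
Qed.

(** By Tonelli and [normal_pdf_convolution], [z] integrates out against a Gaussian
    density of total mass 1. *)
Lemma ge0_normal_semigroup (g : R -> R) (x a b c : R) :
  0 <= a -> 0 <= b -> 0 <= c -> c ^+ 2 = a ^+ 2 + b ^+ 2 ->
  continuous g -> (forall y, 0 <= g y) ->
  (\int[N01]_z \int[N01]_y (g (x + b * z + a * y))%:E =
   \int[N01]_u (g (x + c * u))%:E)%E.
Proof.
rewrite le_eqVlt => /predU1P[<-{a} b0 c0 cE cg g0|a0].
  have -> : c = b.
    by apply/eqP; rewrite -(eqrXn2 (n := 2))// cE expr0n/= add0r.
  apply: eq_integral => z _.
  under eq_integral do rewrite mul0r addr0.
  by rewrite integral_cst//= probability_setT mule1.
rewrite le_eqVlt => /predU1P[<-{b} c0 cE cg g0|b0].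
  have -> : c = a.
    by apply/eqP; rewrite -(eqrXn2 (n := 2)) ?(ltW a0)// cE expr0n/= addr0.
  rewrite (eq_integral (fun=> (\int[N01]_y (g (x + a * y))%:E)%E)).
    by rewrite integral_cst//= probability_setT mule1.
  by move=> z _; under eq_integral do rewrite mul0r addr0.
move=> c0 cE cg g0.
have {}c0 : 0 < c.
  rewrite lt_neqAle c0 andbT; apply/eqP => c00.
  move: cE; rewrite -c00 expr0n/= => /esym/eqP.
  by rewrite paddr_eq0 ?sqr_ge0// => /andP[]; rewrite sqrf_eq0 gt_eqF.
rewrite ge0_integral_normal_affine//.
under eq_integral do rewrite (ge0_integral_normal_affine _ a0 cg g0).
have mg : measurable_fun setT g by exact: continuous_measurable_fun.
have mK : measurable_fun setT
    (fun zu : R * R => g zu.2 * normal_pdf (x + b * zu.1) a zu.2).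
  apply: measurable_funM; first exact: measurableT_comp.
  rewrite (_ : (fun _ => _) = (fun zu : R * R => normal_peak 1 / a *
      expR (- (zu.2 - (x + b * zu.1)) ^+ 2 / (2 * a ^+ 2)))); last first.
    by apply/funext => zu; rewrite normal_pdf_peak1E.
  apply: measurable_funM => //; apply: measurableT_comp => //.
  apply: measurable_funM => //; apply: measurableT_comp => //.
  apply: measurable_funX; apply: measurable_funB => //.
  by apply: measurable_funD => //; apply: measurable_funM.
have mN : measurable_fun setT (fun zu : R * R => normal_pdf (0 : R) 1 zu.1).
  by apply: measurableT_comp => //; exact: measurable_normal_pdf.
rewrite ge0_integral_normal_prob; last 2 first.
- apply: (@measurable_fun_fubini_tonelli_F _ _ _ _ _ lam
    (fun zu : R * R => ((g zu.2)%:E * (normal_pdf (x + b * zu.1) a zu.2)%:E)%E)).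
    by under eq_fun do rewrite -EFinM; exact/measurable_EFinP.
  by move=> zu; rewrite -EFinM lee_fin mulr_ge0 ?normal_pdf_ge0.
- move=> z; apply: integral_ge0 => u _.
  by rewrite -EFinM lee_fin mulr_ge0 ?normal_pdf_ge0.
transitivity (\int[lam]_z \int[lam]_u
   (g u * normal_pdf (x + b * z) a u * normal_pdf 0 1 z)%:E)%E.
  apply: eq_integral => z _.
  rewrite -ge0_integralZr//.
  - apply/measurable_EFinP.
    exact: (measurableT_comp mK (measurable_pair1 z)).
  - by move=> u _; rewrite -EFinM lee_fin mulr_ge0 ?normal_pdf_ge0.
  - by rewrite lee_fin normal_pdf_ge0.
have FT := @fubini_tonelli _ _ _ _ _ lam lam (fun zu : R * R =>
  (g zu.2 * normal_pdf (x + b * zu.1) a zu.2 * normal_pdf 0 1 zu.1)%:E).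
rewrite FT/=; first last.
- by move=> zu; rewrite lee_fin !mulr_ge0 ?normal_pdf_ge0.
- by apply/measurable_EFinP; exact: measurable_funM.
apply: eq_integral => u _.
pose q z : R := normal_pdf (b * (u - x) / c ^+ 2) (a / c) z.
have mq : measurable_fun setT (fun z => (q z)%:E).
  by apply/measurable_EFinP; exact: measurable_normal_pdf.
have q1 : (\int[lam]_z (q z)%:E = 1)%E by exact: integral_normal_pdf.
have q0 z : setT z -> (0 <= (q z)%:E)%E.
  by move=> _; rewrite lee_fin; exact: normal_pdf_ge0.
have k0 : (0 <= (g u * normal_pdf x c u)%:E)%E.
  by rewrite lee_fin mulr_ge0 ?normal_pdf_ge0.
transitivity (\int[lam]_z ((g u * normal_pdf x c u)%:E * (q z)%:E))%E.
  apply: eq_integral => z _; rewrite -EFinM; congr EFin.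
  by rewrite -mulrA (normal_pdf_convolution _ _ _ a0 b0 c0 cE) mulrA.
by rewrite (ge0_integralZl lam measurableT mq q0 k0) q1 mule1 EFinM.
Qed.

End gaussian.

(** * Moments of the standard Gaussian law *)

Section gaussian_moments.
Context (R : realType).
Local Notation lam := (@lebesgue_measure R).
Local Notation N01 := (normal_prob (0 : R) 1).
Local Notation pdf := (normal_pdf (0 : R) 1).

Lemma normal_pdf01E : pdf = fun y => normal_peak 1 * expR (- y ^+ 2 / 2).
Proof.
apply/funext => y; rewrite normal_pdf_peak1E // subr0 expr1n mulr1 divr1//.
Qed.

Lemma is_derive_normal_pdf (y : R) : is_derive y 1 pdf (- (y * pdf y)).
Proof.
rewrite normal_pdf01E.
have h : is_derive y 1 (fun y : R => - y ^+ 2 / 2) (- y).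
  have E : (fun y : R => - y ^+ 2 / 2) = (fun y : R => (- 2^-1) *: (y ^+ 2)).
    by apply/funext => z; rewrite /GRing.scale/=; ring.
  rewrite E; apply: is_derive_eq.
  by rewrite /GRing.scale/=; field.
have := @is_derive1_comp _ expR _ _ _ _ (is_derive_expR _) h.
move=> h2.
have E : (fun y : R => normal_peak 1 * expR (- y ^+ 2 / 2)) =
   (fun y : R => normal_peak 1 *: ((expR \o (fun y : R => - y ^+ 2 / 2)) y)) by [].
rewrite E; apply: is_derive_eq.
by rewrite /GRing.scale/=; ring.
Qed.

Lemma normal_pdf_le (y : R) : 0 < y -> y * pdf y <= normal_peak 1 * 2 / y.
Proof.
move=> y0; have p0 := normal_peak_ge0 (1 : R).
have E : y ^+ 2 * expR (- y ^+ 2 / 2) <= 2.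
  rewrite mulNr expRN ler_pdivrMr ?expR_gt0//.
  by have := expR_ge1Dx (y ^+ 2 / 2); lra.
rewrite normal_pdf01E ler_pdivlMr//.
rewrite (_ : y * _ * y = normal_peak 1 * (y ^+ 2 * expR (- y ^+ 2 / 2))).
  by rewrite ler_wpM2l.
by ring.
Qed.

Lemma cvg_mul_normal_pdf : (y * pdf y) @[y --> +oo] --> (0 : R).
Proof.
apply/cvgrPdist_le => e e0.
near=> y.
have y0 : 0 < y by near: y; exact: nbhs_pinfty_gt.
rewrite sub0r normrN ger0_norm ?mulr_ge0 ?normal_pdf_ge0 ?(ltW y0)//.
rewrite (le_trans (normal_pdf_le y0))// ler_pdivrMr// (mulrC e) -ler_pdivrMr//.
Unshelve. all: by end_near. Qed.

Lemma continuous_pdf : continuous pdf.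
Proof. exact: continuous_normal_pdf. Qed.

Let integral_split1 (f : R -> R) : continuous f -> (forall y, 0 <= f y) ->
  (\int[lam]_(y in `[0%R, +oo[) (f y)%:E =
   \int[lam]_(y in `[0%R, 1%R]) (f y)%:E + \int[lam]_(y in `[1%R, +oo[) (f y)%:E)%E.
Proof.
move=> cf f0.
have mf (A : set R) : measurable_fun A (EFin \o f).
  by apply/measurable_EFinP/measurable_funTS; exact: continuous_measurable_fun.
rewrite -(integral_itv_obnd_cbnd (r := 1)); last exact: mf.
rewrite -ge0_integral_setU//.
- congr (integral _ _ _); apply/seteqP; split => y /=; rewrite !in_itv/= ?andbT.
    by move=> ->; rewrite /=; have [|] := leP y 1; [left|right].
  by move=> [/andP[]//|]; lra.
- exact: mf.
- by move=> y _; rewrite lee_fin.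
- apply/disj_set2P; apply/seteqP; split => y //=; rewrite !in_itv/= andbT.
  by move=> [/andP[_ +]]; lra.
Qed.

Let cy2pdf : continuous (fun y : R => y ^+ 2 * pdf y).
Proof. by move=> y; apply: cvgM; [exact: exprn_continuous|exact: continuous_pdf]. Qed.

Let cypdf : continuous (fun y : R => y * pdf y).
Proof. by move=> y; apply: cvgM; [exact: cvg_id|exact: continuous_pdf]. Qed.

Let dypdf (y : R) : is_derive y 1 (fun y : R => y * pdf y) ((1 - y ^+ 2) * pdf y).
Proof.
have h := is_derive_normal_pdf y.
have -> : (fun y : R => y * pdf y) = (fun y : R => y *: pdf y) by [].
have := is_deriveM (is_derive_id y (1 : R)) h.
move=> h2; apply: (is_derive_eq h2).
by rewrite /GRing.scale/=; ring.
Qed.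

(** [y * pdf y] is a primitive of [(1 - y ^+ 2) * pdf y].  The two halves of the half
    line, on which this function has constant sign, contribute [pdf 1] and
    [- pdf 1]; keeping them apart avoids any subtraction of infinite quantities. *)
Lemma normal_second_moment_half :
  (\int[lam]_(y in `[0%R, +oo[) (y ^+ 2 * pdf y)%:E =
   \int[lam]_(y in `[0%R, +oo[) (pdf y)%:E)%E.
Proof.
have p0 (y : R) : 0 <= pdf y by exact: normal_pdf_ge0.
have mI (f : R -> R) (A : set R) : continuous f -> measurable_fun A (EFin \o f).
  move=> cf.
  by apply/measurable_EFinP/measurable_funTS; exact: continuous_measurable_fun.
have c1 : continuous (fun y : R => (1 - y ^+ 2) * pdf y).
  move=> y; apply: cvgM; last exact: continuous_pdf.
  by apply: (@cvgB _ R^o); [exact: cvg_cst|exact: exprn_continuous].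
have c2 : continuous (fun y : R => (y ^+ 2 - 1) * pdf y).
  move=> y; apply: cvgM; last exact: continuous_pdf.
  by apply: (@cvgB _ R^o); [exact: exprn_continuous|exact: cvg_cst].
have D : (\int[lam]_(y in `[0%R, 1%R]) ((1 - y ^+ 2) * pdf y)%:E = (pdf 1)%:E)%E.
  rewrite (@continuous_FTC2 _ _ (fun y : R => y * pdf y)) ?ltr01//.
  - by rewrite mul0r mul1r sube0.
  - exact: continuous_subspaceT.
  - split; first by move=> y _; exact: (@ex_derive _ _ _ _ _ _ _ (dypdf y)).
    + by apply: cvg_at_right_filter; exact: cypdf.
    + by apply: cvg_at_left_filter; exact: cypdf.
  - by move=> y _; rewrite derive1E (@derive_val _ _ _ _ _ _ _ (dypdf y)).
have E : (\int[lam]_(y in `[1%R, +oo[) ((y ^+ 2 - 1) * pdf y)%:E = (pdf 1)%:E)%E.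
  rewrite (@ge0_continuous_FTC2y _ _ (fun y : R => - (y * pdf y)) _ 0).
  - by rewrite mul1r sub0e EFinN oppeK.
  - by move=> y y1; rewrite mulr_ge0// subr_ge0 exprn_ege1.
  - exact: continuous_subspaceT.
  - have := @cvgN _ R^o _ _ _ _ _ cvg_mul_normal_pdf; rewrite oppr0; exact.
  - by move=> y _; apply: derivableN; exact: (@ex_derive _ _ _ _ _ _ _ (dypdf y)).
  - by apply: cvg_at_right_filter; apply: cvgN; exact: cypdf.
  - move=> y _; rewrite derive1E deriveN; last first.
      exact: (@ex_derive _ _ _ _ _ _ _ (dypdf y)).
    by rewrite (@derive_val _ _ _ _ _ _ _ (dypdf y)); ring.
rewrite !integral_split1//; last 2 first.
- exact: continuous_pdf.
- by move=> y; rewrite mulr_ge0// sqr_ge0.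
rewrite [X in (_ + X = _)%E](_ : _ = \int[lam]_(y in `[1%R, +oo[)
    (((y ^+ 2 - 1) * pdf y)%:E + (pdf y)%:E))%E; last first.
  by apply: eq_integral => y _; rewrite -EFinD; congr EFin; ring.
rewrite [X in (_ = X + _)%E](_ : _ = \int[lam]_(y in `[0%R, 1%R])
    ((y ^+ 2 * pdf y)%:E + ((1 - y ^+ 2) * pdf y)%:E))%E; last first.
  by apply: eq_integral => y _; rewrite -EFinD; congr EFin; ring.
rewrite ge0_integralD//; last 4 first.
- by move=> y /=; rewrite in_itv/= andbT => y1; rewrite lee_fin mulr_ge0// subr_ge0 exprn_ege1.
- exact: mI.
- by move=> y _; rewrite lee_fin.
- by apply: mI; exact: continuous_pdf.
rewrite ge0_integralD//; last 4 first.
- by move=> y _; rewrite lee_fin mulr_ge0// sqr_ge0.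
- exact: mI.
- move=> y /=; rewrite in_itv/= => /andP[y0 y1].
  by rewrite lee_fin mulr_ge0// subr_ge0 exprn_ile1.
- exact: mI.
by rewrite D E addeA.
Qed.

Lemma normal_even : (forall y, pdf (- y) = pdf y).
Proof. by move=> y; rewrite normal_pdf01E sqrrN. Qed.

Lemma normal_second_moment : (\int[N01]_y (y ^+ 2)%:E = 1)%E.
Proof.
rewrite ge0_integral_normal_prob; last 2 first.
- by apply/measurable_EFinP; exact: measurable_funX.
- by move=> y; rewrite lee_fin sqr_ge0.
under eq_integral do rewrite -EFinM.
have c2 : continuous (fun y : R => y ^+ 2 * pdf y).
  by move=> y; apply: cvgM; [exact: exprn_continuous|exact: continuous_pdf].
rewrite ge0_symfun_integralT//; last 2 first.
- by move=> y; rewrite mulr_ge0 ?sqr_ge0 ?normal_pdf_ge0.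
- by move=> y; rewrite /= sqrrN normal_even.
rewrite -(integral_normal_pdf (0 : R) 1) ge0_symfun_integralT//; last 3 first.
- by move=> y; rewrite normal_pdf_ge0.
- exact: continuous_pdf.
- by move=> y; rewrite /= normal_even.
by rewrite -!set_itvcy normal_second_moment_half.
Qed.

Lemma sqint_normal : sqint N01 (fun y : measurableTypeR R => y : R).
Proof.
split; first exact: measurable_id.
apply/integrableP; split.
  by apply/measurable_EFinP; exact: measurable_funX.
under eq_integral do rewrite gee0_abs ?lee_fin ?sqr_ge0//.
by rewrite normal_second_moment ltry.
Qed.

Lemma ge0_integral_normalN (g : R -> R) : measurable_fun setT g ->
  (forall y, 0 <= g y) ->
  (\int[N01]_y (g (- y))%:E = \int[N01]_y (g y)%:E)%E.
Proof.
move=> mg g0.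
have mgN : measurable_fun setT (fun y : R => g (- y)) by exact: measurableT_comp.
rewrite (@ge0_integral_normal_prob _ _ _ (fun y => (g (- y))%:E)); last 2 first.
- exact/measurable_EFinP.
- by move=> y; rewrite lee_fin.
rewrite (@ge0_integral_normal_prob _ _ _ (fun y => (g y)%:E)); last 2 first.
- exact/measurable_EFinP.
- by move=> y; rewrite lee_fin.
pose h (y : R) := ((g y)%:E * (pdf y)%:E)%E.
transitivity (\int[pushforward lam (-%R : _ -> measurableTypeR R)]_y h y)%E.
  have mh : measurable_fun setT h.
    apply: emeasurable_funM; apply/measurable_EFinP => //.
    exact: measurable_normal_pdf.
  have h0 : {in setT, forall y, (0 <= h y)%E}.
    by move=> y _; rewrite /h -EFinM lee_fin mulr_ge0// normal_pdf_ge0.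
  have mN : measurable_fun setT (-%R : measurableTypeR R -> measurableTypeR R).
    exact: oppr_measurable.
  rewrite (ge0_integral_pushforward mN _ measurableT mh h0) preimage_setT.
  by apply: eq_integral => y _; rewrite /h /= normal_even.
by apply: eq_measure_integral => A mA _; exact: lebesgue_measureN.
Qed.

(** By symmetry, [(1 + y) ^+ 2] and [(1 - y) ^+ 2] have the same integral. *)
Lemma normal_first_moment : \int[N01]_y y = 0.
Proof.
have i1 : intble N01 (fun y : measurableTypeR R => y : R).
  exact: sqint_intble sqint_normal.
have i2 := sqint_normal.2.
have i0 : intble N01 (fun=> 1) := intble_cst N01 1.
have E (e : R) : \int[N01]_y (1 + e * y) ^+ 2 =
    1 + 2 * e * \int[N01]_y y + e ^+ 2 * \int[N01]_y (y ^+ 2).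
  transitivity (\int[N01]_y (1 + 2 * e * y + e ^+ 2 * y ^+ 2)).
    by apply: eq_Rintegral => y _; ring.
  have j1 := intbleZ (2 * e) i1; have j2 := intbleZ (e ^+ 2) i2.
  rewrite RintegralD//; last exact: intbleD.
  by rewrite RintegralD// Rint_cst !RintegralZl.
have : \int[N01]_y (1 + 1 * y) ^+ 2 = \int[N01]_y (1 + -1 * y) ^+ 2.
  rewrite /Rintegral -(@ge0_integral_normalN (fun y => (1 + 1 * y) ^+ 2)).
  - by congr fine; apply: eq_integral => y _; rewrite mul1r mulN1r.
  - by apply: measurable_funX; apply: measurable_funD => //; apply: measurable_funM.
  - by move=> y; rewrite sqr_ge0.
rewrite !E; move: (\int[N01]_y y) (\int[N01]_y (y ^+ 2)) => m v.
by clear i0 i1 i2 E; lra.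
Qed.

Lemma normal_second_momentR : \int[N01]_y (y ^+ 2) = 1.
Proof. by rewrite /Rintegral normal_second_moment. Qed.

End gaussian_moments.

(** * Taylor expansions under the integral sign *)

Section taylor_average.
Context d (T : measurableType d) (R : realType) (Q : probability T R).
Variables (p p1 p2 : R -> R) (C : R).
Hypothesis tp : taylor2 p p1 p2 C.

Lemma taylor2_continuous : [/\ continuous p, continuous p1 & continuous p2].
Proof.
have [C0 _ lip _] := tp.
by split; apply: (lipschitz_continuous C0) => x y; have [] := lip x y.
Qed.

Lemma taylor2_measurable :
  [/\ measurable_fun setT p, measurable_fun setT p1 & measurable_fun setT p2].
Proof.
have [c0 c1 c2] := taylor2_continuous.
by split; apply: continuous_measurable_fun.
Qed.

Lemma taylor2_intble (U : T -> R) : measurable_fun setT U ->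
  [/\ intble Q (fun w => p (U w)), intble Q (fun w => p1 (U w)) &
      intble Q (fun w => p2 (U w))].
Proof.
move=> mU; have [m0 m1 m2] := taylor2_measurable.
have [_ b _ _] := tp.
by split; apply: (@intble_bounded _ _ _ _ _ C);
  (try exact: measurableT_comp) => w; have [] := b (U w).
Qed.

Lemma taylor2_average (z : T -> R) : measurable_fun setT z ->
  taylor2 (fun x => \int[Q]_w p (x + z w)) (fun x => \int[Q]_w p1 (x + z w))
    (fun x => \int[Q]_w p2 (x + z w)) C.
Proof.
move=> mz; have [C0 b lip ex] := tp.
have mxz x : measurable_fun setT (fun w => x + z w) by exact: measurable_funD.
have I x := taylor2_intble (mxz x).
have avg_bnd (q : R -> R) (D : R) (x : R) : intble Q (fun w => q (x + z w)) ->
    (forall u, `|q u| <= D) -> `|\int[Q]_w q (x + z w)| <= D.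
  move=> iq qD.
  rewrite (le_trans (le_normr_Rintegral measurableT iq))// -[leRHS](Rint_cst Q).
  by apply: le_Rintegral => //; [exact: integrable_norm|exact: intble_cst].
have avg_lip (q : R -> R) (x y : R) : intble Q (fun w => q (x + z w)) ->
    intble Q (fun w => q (y + z w)) ->
    (forall u v, `|q u - q v| <= C * `|u - v|) ->
    `|\int[Q]_w q (x + z w) - \int[Q]_w q (y + z w)| <= C * `|x - y|.
  move=> ix iy ql; rewrite -[leRHS](Rint_cst Q).
  apply: Rint_dist => //; first exact: intble_cst.
  move=> w; rewrite (le_trans (ql _ _))//.
  by rewrite opprD addrACA subrr addr0.
split => //.
- move=> x; have [I0 I1 I2] := I x.
  by split; apply: avg_bnd => // u; have [] := b u.
- move=> x y; have [I0 I1 I2] := I x; have [J0 J1 J2] := I y.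
  by split; apply: avg_lip => // u v; have [] := lip u v.
- move=> x h; have [I0 I1 I2] := I x; have [J0 J1 J2] := I (x + h).
  have i1 := intbleZ h I1; have i2 := intbleZ (h ^+ 2 / 2) I2.
  have -> : \int[Q]_w p (x + h + z w) - \int[Q]_w p (x + z w) -
      \int[Q]_w p1 (x + z w) * h - \int[Q]_w p2 (x + z w) * h ^+ 2 / 2 =
      \int[Q]_w p (x + h + z w) - \int[Q]_w (p (x + z w) +
      h * p1 (x + z w) + (h ^+ 2 / 2) * p2 (x + z w)).
    rewrite RintegralD//; last exact: intbleD.
    by rewrite RintegralD// !RintegralZl//; ring.
  rewrite -[leRHS](Rint_cst Q); apply: Rint_dist => //.
  + exact: intbleD (intbleD I0 i1) i2.
  + exact: intble_cst.
  + move=> w; have := ex (x + z w) h.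
    rewrite [X in `|X| <= _ -> _](_ : _ = p (x + h + z w) - (p (x + z w) +
      h * p1 (x + z w) + (h ^+ 2 / 2) * p2 (x + z w)))//.
    by rewrite (_ : x + z w + h = x + h + z w); ring.
Qed.

(** The Taylor remainder at increment [t * u] is at most [4 C (t u)^2 min (1, |t u|)]:
    the cubic bound is used for small increments, boundedness for large ones.
    The minimum keeps it integrable for every square integrable [u]. *)
Definition truncated_sqr (t u : R) := u ^+ 2 * Num.min 1 `|t * u|.

Lemma truncated_sqr_bnd t u : 0 <= truncated_sqr t u <= u ^+ 2.
Proof.
have m0 : 0 <= Num.min 1 `|t * u| by rewrite le_min ler01/=.
have m1 : Num.min 1 `|t * u| <= 1 by rewrite ge_min lexx.
by rewrite mulr_ge0 ?sqr_ge0//= ler_piMr// sqr_ge0.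
Qed.

Lemma measurable_truncated_sqr (z : T -> R) t : measurable_fun setT z ->
  measurable_fun setT (fun w => truncated_sqr t (z w)).
Proof.
move=> mz; apply: measurable_funM; first exact: measurable_funX.
apply: (@measurable_minr _ _ _ _ (fun=> 1)) => //; apply: measurableT_comp => //.
exact: measurable_funM.
Qed.

Lemma intble_truncated_sqr (z : T -> R) t : sqint Q z ->
  intble Q (fun w => truncated_sqr t (z w)).
Proof.
move=> [mz z2]; apply: intble_dom z2; first exact: measurable_truncated_sqr.
by move=> w; have /andP[a b] := truncated_sqr_bnd t (z w); rewrite ger0_norm.
Qed.

Lemma taylor2_rem (x t u : R) :
  `|p (x + t * u) - (p x + t * p1 x * u + t ^+ 2 / 2 * p2 x * u ^+ 2)| <=
  4 * C * t ^+ 2 * truncated_sqr t u.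
Proof.
have [C0 b _ ex] := tp.
set h := t * u.
have -> : 4 * C * t ^+ 2 * truncated_sqr t u = 4 * C * (h ^+ 2 * Num.min 1 `|h|).
  by rewrite /truncated_sqr /h exprMn; ring.
have -> : p x + t * p1 x * u + t ^+ 2 / 2 * p2 x * u ^+ 2 =
    p x + p1 x * h + p2 x * h ^+ 2 / 2 by rewrite /h; ring.
have h2 : h ^+ 2 = `|h| ^+ 2 by rewrite real_normK ?num_real.
have [h1|h1] := leP 1 `|h|.
  have [/ler_normlP[a1 a2] _ _] := b x.
  have [/ler_normlP[b1 b2] _ _] := b (x + h).
  have : `|p1 x * h| <= C * `|h| by rewrite normrM ler_wpM2r//; have [] := b x.
  have : `|p2 x * h ^+ 2| <= C * h ^+ 2.
    by rewrite normrM h2 normrX normr_id ler_wpM2r ?exprn_ge0//; have [] := b x.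
  have : C <= C * h ^+ 2 by rewrite ler_peMr// h2 exprn_ege1.
  have : C * `|h| <= C * h ^+ 2.
    by rewrite ler_wpM2l// h2 expr2 ler_peMr// (le_trans _ h1).
  rewrite !ler_norml mulr1 => c1 c2 /andP[c3 c4] /andP[c5 c6].
  by clear -a1 a2 b1 b2 c1 c2 c3 c4 c5 c6; apply/andP; split; lra.
have := ex x h.
rewrite [X in `|X| <= _ -> _](_ : _ =
  p (x + h) - (p x + p1 x * h + p2 x * h ^+ 2 / 2)); last by ring.
move=> H; rewrite (le_trans H)// h2 -exprSr -mulrA.
have : 0 <= C * `|h| ^+ 3 by rewrite mulr_ge0 ?exprn_ge0.
by move: (C * _) => K; lra.
Qed.

(** Only the first two moments of [z] enter the main term: this is what makes two
    variables with the same mean and variance interchangeable. *)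
Lemma taylor2_average_rem (z : T -> R) (x t : R) :
  sqint Q z -> \int[Q]_w z w = 0 ->
  `|\int[Q]_w p (x + t * z w) -
    (p x + t ^+ 2 / 2 * p2 x * \int[Q]_w (z w) ^+ 2)| <=
  4 * C * t ^+ 2 * \int[Q]_w truncated_sqr t (z w).
Proof.
move=> z2 z0; have [mz iz2] := z2; have iz := sqint_intble z2.
have mxz : measurable_fun setT (fun w => x + t * z w).
  by apply: measurable_funD => //; apply: measurable_funM.
have [I0 _ _] := taylor2_intble mxz.
have i1 := intbleZ (t * p1 x) iz; have i2 := intbleZ (t ^+ 2 / 2 * p2 x) iz2.
have i0 : intble Q (fun=> p x) by exact: intble_cst.
have it := intble_truncated_sqr t z2.
have -> : p x + t ^+ 2 / 2 * p2 x * \int[Q]_w z w ^+ 2 =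
    \int[Q]_w (p x + t * p1 x * z w + t ^+ 2 / 2 * p2 x * z w ^+ 2).
  rewrite RintegralD//; last exact: intbleD.
  by rewrite RintegralD// !RintegralZl// z0 mulr0 addr0 Rint_cst.
rewrite -RintegralZl//; apply: Rint_dist => //.
- exact: intbleD (intbleD i0 i1) i2.
- exact: intbleZ.
- by move=> w; exact: taylor2_rem.
Qed.

End taylor_average.

Section gaussian_smoothing.
Context (R : realType).
Local Notation N01 := (normal_prob (0 : R) 1).
Implicit Types p : R -> R.

(** Reduces to the nonnegative case by adding the constant [C]. *)
Lemma normal_semigroup p (x a b c : R) : taylor_class p ->
  0 <= a -> 0 <= b -> 0 <= c -> c ^+ 2 = a ^+ 2 + b ^+ 2 ->
  \int[N01]_z \int[N01]_y p (x + b * z + a * y) = \int[N01]_u p (x + c * u).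
Proof.
move=> [p1 [p2 [C tp]]] a0 b0 c0 cE.
have [cp _ _] := taylor2_continuous tp.
have mid : measurable_fun [set: measurableTypeR R] (fun y => y : R) by exact: measurable_id.
have maff (u a' : R) : measurable_fun [set: measurableTypeR R] (fun y => u + a' * y).
  by apply: measurable_funD => //; apply: measurable_funM.
have I (u a' : R) : intble N01 (fun y => p (u + a' * y)).
  by have [] := taylor2_intble N01 tp (maff u a').
have tG := taylor2_average N01 tp (maff 0 a).
have IG : intble N01 (fun z => \int[N01]_y p (x + b * z + a * y)).
  have [+ _ _] := taylor2_intble N01 tG (maff x b).
  by apply: eq_integrable => // z _ /=; under eq_Rintegral do rewrite add0r.
pose g u := p u + C.
have g0 u : 0 <= g u.
  have [_ /(_ u)[+ _ _] _ _] := tp; rewrite ler_norml /g => /andP[+ _].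
  by rewrite -subr_ge0 opprK.
have cg : continuous g.
  by move=> u; apply: (@cvgD _ R^o); [exact: cp|exact: cvg_cst].
have := ge0_normal_semigroup x a0 b0 c0 cE cg g0.
have E (u a' : R) : (\int[N01]_y (g (u + a' * y))%:E =
    (\int[N01]_y p (u + a' * y) + C)%:E)%E.
  rewrite -[X in (_ + X)%:E](Rint_cst N01) -RintegralD//; last exact: intble_cst.
  rewrite /Rintegral fineK//; apply: integrable_fin_num => //.
  exact: intbleD (I _ _) (intble_cst _ _).
rewrite E; under eq_integral do rewrite E.
move=> /(congr1 fine)/=; rewrite -/(Rintegral _ _ _) RintegralD//; last exact: intble_cst.
by rewrite Rint_cst => /addIr.
Qed.

(** For [s = 0] both sides are [p 0]: the form on the right treats the degenerate
    Gaussian law and the others alike. *)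
Lemma integral_gaussian0 p (s : R) : taylor_class p -> 0 <= s ->
  \int[gaussian 0 (s ^+ 2)]_x p x = \int[N01]_y p (s * y).
Proof.
move=> [p1 [p2 [C tp]]] s0.
have [cp _ _] := taylor2_continuous tp.
rewrite /gaussian sqrf_eq0.
have mp : measurable_fun [set: measurableTypeR R] p.
  exact: continuous_measurable_fun.
case: eqVneq => [->|sn0].
  rewrite /Rintegral integral_dirac//; last exact/measurable_EFinP.
  rewrite diracT mul1e/=.
  under eq_integral do rewrite mul0r.
  by rewrite -/(Rintegral _ _ _) Rint_cst.
have sqE : Num.sqrt (s ^+ 2) = s by rewrite sqrtr_sqr ger0_norm.
rewrite sqE.
have {}s0 : 0 < s by rewrite lt_neqAle eq_sym sn0.
pose g u := p u + C.
have g0 u : 0 <= g u.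
  have [_ /(_ u)[+ _ _] _ _] := tp; rewrite ler_norml /g => /andP[+ _].
  by rewrite -subr_ge0 opprK.
have cg : continuous g.
  by move=> u; apply: (@cvgD _ R^o); [exact: cp|exact: cvg_cst].
have mg : measurable_fun [set: measurableTypeR R] g.
  exact: continuous_measurable_fun.
have H := @ge0_integral_normal_affine _ g 0 s s0 cg g0.
rewrite -ge0_integral_normal_prob in H; last 2 first.
- exact/measurable_EFinP.
- by move=> x; rewrite lee_fin.
have mid : measurable_fun [set: measurableTypeR R] (fun y => y : R) by exact: measurable_id.
have msy : measurable_fun [set: measurableTypeR R] (fun y => s * y).
  exact: measurable_funM.
have [I0 _ _] := taylor2_intble N01 tp msy.
have [J0 _ _] := taylor2_intble (normal_prob 0 s) tp mid.
have {}H : \int[normal_prob 0 s]_x (p x + C) = \int[N01]_y (p (s * y) + C).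
  rewrite /Rintegral -H; congr fine; apply: eq_integral => y _.
  by rewrite add0r.
have E1 := RintegralD measurableT J0 (intble_cst (normal_prob 0 s) C).
have E2 := RintegralD measurableT I0 (intble_cst N01 C).
have := etrans (esym E1) (etrans H E2); rewrite !Rint_cst.
exact: addIr.
Qed.

End gaussian_smoothing.

(** * The central limit theorem by Lindeberg replacement *)

Lemma cvg_inv_sqrt (R : realType) :
  (Num.sqrt n.+1%:R)^-1 @[n --> \oo] --> (0 : R).
Proof.
apply/cvgrPdist_le => e e0; near=> n.
rewrite sub0r normrN ger0_norm ?invr_ge0//.
rewrite invf_ple ?posrE ?sqrtr_gt0// -[leLHS]ger0_norm ?invr_ge0 ?(ltW e0)//.
rewrite -sqrtr_sqr ler_wsqrtr// (@le_trans _ _ n%:R)//; last by rewrite ler_nat.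
near: n; exact: nbhs_infty_ger.
Unshelve. all: by end_near. Qed.

Section truncated_sqr_vanishes.
Context d (T : measurableType d) (R : realType) (Q : probability T R).

Lemma cvg_truncated_sqr (z : T -> R) : sqint Q z ->
  (\int[Q]_w truncated_sqr (Num.sqrt n.+1%:R)^-1 (z w)) @[n --> \oo] --> (0 : R).
Proof.
move=> z2; have [mz iz2] := z2.
have mt n : measurable_fun setT (EFin \o (fun w => truncated_sqr (Num.sqrt n.+1%:R)^-1 (z w))).
  by apply/measurable_EFinP; exact: measurable_truncated_sqr.
have pt w : setT w ->
    (EFin \o (fun w => truncated_sqr (Num.sqrt n.+1%:R)^-1 (z w))) w @[n --> \oo] --> 0%E.
  move=> _; apply: cvg_EFin; first exact: nearW.
  have s0 := @cvg_inv_sqrt R.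
  apply: (@squeeze_cvgr _ _ _ _ (fun=> 0) (fun n => z w ^+ 2 * `|(Num.sqrt n.+1%:R)^-1 * z w|)).
  - near=> n; rewrite /= /truncated_sqr; apply/andP; split.
      by have /andP[] := truncated_sqr_bnd (Num.sqrt n.+1%:R)^-1 (z w).
    by rewrite ler_wpM2l ?sqr_ge0// ge_min lexx orbT.
  - exact: cvg_cst.
  - rewrite -[X in _ --> X](mulr0 (z w ^+ 2)); apply: cvgM; first exact: cvg_cst.
    rewrite -(@normr0 _ R); apply: cvg_norm.
    rewrite -[X in _ --> X](mul0r (z w)).
    by apply: cvgM; [exact: s0|exact: cvg_cst].
have iz : Q.-integrable setT (fun w => (z w ^+ 2)%:E) by exact: iz2.
have bd n w : setT w ->
    (`|(EFin \o (fun w => truncated_sqr (Num.sqrt n.+1%:R)^-1 (z w))) w| <= (z w ^+ 2)%:E)%E.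
  move=> _; rewrite /= lee_fin.
  by have /andP[a b] := truncated_sqr_bnd (Num.sqrt n.+1%:R)^-1 (z w); rewrite ger0_norm.
have := @dominated_cvg _ _ _ Q setT measurableT _ _ (fun w => (z w ^+ 2)%:E)
  mt pt (fun _ _ => isT) iz bd.
rewrite integral0; exact: (@fine_cvg _ _ _ _ _ (0 : R)).
Unshelve. all: by end_near. Qed.

End truncated_sqr_vanishes.

Section lindeberg.
Context d (T : measurableType d) (R : realType) (P : probability T R).
Context d1 (T1 : measurableType d1).
Variables (W : nat -> T -> T1) (mW : forall i, measurable_fun setT (W i)).
Variables (W0 : T -> T1) (mW0 : measurable_fun setT W0).
Hypothesis iW : iid_copies P W W0.
Variable (k : T1 -> R).
Hypothesis mk : measurable_fun setT k.
Hypothesis k2 : sqint P (fun w => k (W0 w)).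
Hypothesis k0 : \int[P]_w k (W0 w) = 0.
Variable s : R.
Hypothesis s0 : 0 <= s.
Hypothesis s2 : s ^+ 2 = \int[P]_w k (W0 w) ^+ 2.
Variables (p p1 p2 : R -> R) (C : R).
Hypothesis tp : taylor2 p p1 p2 C.
Local Notation N01 := (normal_prob (0 : R) 1).

Let sN : sqint N01 (fun y : measurableTypeR R => s * y).
Proof. exact: sqintZ (sqint_normal R). Qed.

Let sN0 : \int[N01]_y (s * y) = 0.
Proof.
rewrite RintegralZl//; last exact: sqint_intble (sqint_normal R).
by rewrite normal_first_moment mulr0.
Qed.

Let sN2 : \int[N01]_y (s * y) ^+ 2 = s ^+ 2.
Proof.
transitivity (\int[N01]_y (s ^+ 2 * y ^+ 2)).
  by apply: eq_Rintegral => y _; rewrite exprMn.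
by rewrite RintegralZl ?normal_second_momentR ?mulr1//; exact: (sqint_normal R).2.
Qed.

Let msy (t : R) :
  measurable_fun [set: measurableTypeR R] (fun y : measurableTypeR R => t * y : R).
Proof. by apply: measurable_funM => //; exact: measurable_id. Qed.

Let S (t : R) m w := t * \sum_(i < m) k (W i w).
Let G (t : R) j x := \int[N01]_y p (x + s * t * Num.sqrt j%:R * y).

Let tG t j : taylor2 (G t j) (fun x => \int[N01]_y p1 (x + s * t * Num.sqrt j%:R * y))
   (fun x => \int[N01]_y p2 (x + s * t * Num.sqrt j%:R * y)) C.
Proof. exact: (taylor2_average N01 tp (msy (s * t * Num.sqrt j%:R))). Qed.

Let mS t m : measurable_fun setT (S t m).
Proof. by apply: measurable_funM => //; exact: (measurable_prefix_sum mW mk m). Qed.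

Let err t := \int[P]_w truncated_sqr t (k (W0 w)) + \int[N01]_y truncated_sqr t (s * y).

Let lindeberg_step (t : R) j m : 0 <= t ->
  `|\int[P]_w G t j.+1 (S t m w) - \int[P]_w G t j (S t m.+1 w)| <=
  4 * C * t ^+ 2 * err t.
Proof.
move=> t0; set psi := G t j.
have tpsi := tG t j.
have [mpsi _ _] := taylor2_measurable tpsi.
(* one step of the semigroup exhibits a Gaussian summand with the variance of
   [k (W m)], to be exchanged with it *)
have GS x : G t j.+1 x = \int[N01]_z psi (x + t * (s * z)).
  rewrite /G -(@normal_semigroup _ p x (s * t * Num.sqrt j%:R) (s * t)).
  - by apply: eq_Rintegral => z _; rewrite /psi /G mulrA (mulrC t).
  - by exists p1, p2, C.
  - by rewrite !mulr_ge0.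
  - by rewrite mulr_ge0.
  - by rewrite !mulr_ge0.
  - by rewrite !exprMn !sqr_sqrtr// -natr1; ring.
have SS w : S t m.+1 w = S t m w + t * k (W m w).
  by rewrite /S big_ord_recr mulrDr.
have mh : measurable_fun setT (fun xy : R * T1 => psi (xy.1 + t * k xy.2)).
  apply: measurableT_comp => //; apply: measurable_funD => //.
  by apply: measurable_funM => //; exact: measurableT_comp.
have mSk : measurable_fun setT (fun w => S t m w + t * k (W m w)).
  apply: measurable_funD => //; apply: measurable_funM => //.
  exact: measurableT_comp.
have indep : independent P (S t m) (W m).
  move=> A B mA mB.
  have := prefix_sum_independent mW m mk iW.1.
  move=> /(_ (( *%R t) @^-1` A) B); apply => //.
  by rewrite -[X in measurable X]setTI; apply: measurable_funM.
have [iI ->] : intble P (fun w => \int[P]_w' psi (S t m w + t * k (W m w'))) /\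
    \int[P]_w psi (S t m.+1 w) = \int[P]_w \int[P]_w' psi (S t m w + t * k (W m w')).
  under [in X in _ /\ X]eq_Rintegral do rewrite SS.
  apply: (@independent_Rintegral _ _ _ _ _ _ _ _ _ _
    (fun xy : R * T1 => psi (xy.1 + t * k xy.2)) (mS t m) (mW m) indep mh).
  by have [] := taylor2_intble P tpsi mSk.
have iG : intble P (fun w => G t j.+1 (S t m w)).
  by have [] := taylor2_intble P (tG t j.+1) (mS t m).
rewrite -[leRHS](Rint_cst P); apply: Rint_dist => //; first exact: intble_cst.
move=> w; rewrite GS.
have -> : \int[P]_w' psi (S t m w + t * k (W m w')) =
    \int[P]_w' psi (S t m w + t * k (W0 w')).
  apply: (@iid_Rintegral _ _ _ _ _ _ W mW W0 mW0 iW
    (fun v => psi (S t m w + t * k v))).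
  apply: measurableT_comp => //; apply: measurable_funD => //.
  exact: measurable_funM.
have r1 := taylor2_average_rem tpsi (S t m w) t k2 k0.
have r2 := taylor2_average_rem tpsi (S t m w) t sN sN0.
rewrite -s2 in r1; rewrite sN2 in r2.
move: r1 r2; set c0 := (psi _ + _) => r1 r2.
rewrite (le_trans (ler_distD c0 _ _))// /err mulrDr [leRHS]addrC lerD//.
by rewrite distrC.
Qed.

Let lindeberg_tele (t : R) n : 0 <= t ->
  `|\int[P]_w G t n (S t 0 w) - \int[P]_w G t 0 (S t n w)| <=
  n%:R * (4 * C * t ^+ 2 * err t).
Proof.
move=> t0; set D := 4 * C * t ^+ 2 * err t.
suff H m : (m <= n)%N ->
    `|\int[P]_w G t n (S t 0 w) - \int[P]_w G t (n - m) (S t m w)| <= m%:R * D.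
  by have := H n (leqnn n); rewrite subnn.
elim: m => [_|m IH mn]; first by rewrite subn0 subrr normr0 mul0r.
have -> : m.+1%:R * D = m%:R * D + D by rewrite -natr1 mulrDl mul1r.
rewrite (le_trans (ler_distD (\int[P]_w G t (n - m) (S t m w)) _ _))//.
apply: lerD; first exact: IH (ltnW mn).
by rewrite -(subnSK mn); exact: lindeberg_step.
Qed.

(** Telescoping sum over the number of replaced summands: the squared scale [t ^+ 2]
    is [n.+1%:R^-1], so the [n.+1] errors add up to one truncated second moment
    for each of the two laws. *)
Lemma lindeberg_bound n (t := (Num.sqrt n.+1%:R)^-1) :
  `|\int[N01]_y p (s * y) - \int[P]_w p (t * \sum_(i < n.+1) k (W i w))| <=
  4 * C * (\int[P]_w truncated_sqr t (k (W0 w)) + \int[N01]_y truncated_sqr t (s * y)).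
Proof.
have sq0 : Num.sqrt n.+1%:R != 0 :> R by rewrite gt_eqF// sqrtr_gt0.
have t0 : 0 <= t by rewrite invr_ge0.
have := lindeberg_tele n.+1 t0.
have -> : n.+1%:R * (4 * C * t ^+ 2 * err t) = 4 * C * err t.
  have -> : t ^+ 2 = n.+1%:R^-1 by rewrite /t exprVn sqr_sqrtr.
  have : n.+1%:R != 0 :> R by rewrite pnatr_eq0.
  by move: (n.+1%:R) => N N0; field.
have -> : \int[P]_w G t n.+1 (S t 0 w) = \int[N01]_y p (s * y).
  rewrite -[RHS](Rint_cst P); apply: eq_Rintegral => w _.
  rewrite /G /S big_ord0 mulr0; apply: eq_Rintegral => y _.
  by rewrite add0r -(mulrA s) /t mulVf// mulr1.
have -> : \int[P]_w G t 0 (S t n.+1 w) = \int[P]_w p (t * \sum_(i < n.+1) k (W i w)).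
  apply: eq_Rintegral => w _; rewrite /G sqrtr0 mulr0.
  by under eq_Rintegral do rewrite mul0r addr0; rewrite Rint_cst.
by [].
Qed.

End lindeberg.

Section central_limit.
Context d (T : measurableType d) (R : realType) (P : probability T R).
Context d1 (T1 : measurableType d1).

Lemma central_limit_taylor (W : nat -> T -> T1) (W0 : T -> T1) (k : T1 -> R)
    (s : R) (p : R -> R) :
  (forall i, measurable_fun setT (W i)) -> measurable_fun setT W0 ->
  iid_copies P W W0 -> measurable_fun setT k ->
  sqint P (fun w => k (W0 w)) -> \int[P]_w k (W0 w) = 0 ->
  0 <= s -> s ^+ 2 = \int[P]_w k (W0 w) ^+ 2 -> taylor_class p ->
  (\int[P]_w p ((Num.sqrt n.+1%:R)^-1 * \sum_(i < n.+1) k (W i w)))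
    @[n --> \oo] --> \int[normal_prob (0 : R) 1]_y p (s * y).
Proof.
move=> mW mW0 iW mk k2 k0 s0 s2 [p1 [p2 [C tp]]].
have b := lindeberg_bound mW mW0 iW mk k2 k0 s0 s2 tp.
have sN := sqintZ s (sqint_normal R).
have h : (4 * C * (\int[P]_w truncated_sqr (Num.sqrt n.+1%:R)^-1 (k (W0 w)) +
    \int[normal_prob (0 : R) 1]_y truncated_sqr (Num.sqrt n.+1%:R)^-1 (s * y)))
    @[n --> \oo] --> (0 : R).
  rewrite -[X in _ --> X](mulr0 (4 * C)); apply: cvgM; first exact: cvg_cst.
  rewrite -[X in _ --> X](addr0 0).
  by apply: (@cvgD _ R^o); [exact: cvg_truncated_sqr k2|exact: cvg_truncated_sqr sN].
apply/cvgrPdist_le => e e0.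
have /cvgrPdist_le/(_ e e0) := h.
apply: filterS => n; rewrite sub0r normrN => H.
by rewrite (le_trans (b n))// (le_trans (ler_norm _)).
Qed.

End central_limit.

(** * Negligible perturbations and ratios of empirical means *)

Section slutsky.
Context d (T : measurableType d) (R : realType) (P : probability T R).

(** A test function is bounded and Lipschitz, so it changes by at most
    [2 * C * Num.min 1 `|U - V|]; the hypothesis is a form of convergence in
    probability of [U - V] to 0 that bounds on mean squares deliver directly. *)
Lemma slutsky_taylor (p : R -> R) (U V Q : nat -> T -> R) (l : R) :
  taylor_class p ->
  (forall n, measurable_fun setT (U n)) -> (forall n, measurable_fun setT (V n)) ->
  (forall n, intble P (Q n)) ->
  (\int[P]_w Q n w) @[n --> \oo] --> (0 : R) ->
  (forall e, 0 < e -> exists K, forall n w,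
     Num.min 1 `|U n w - V n w| <= e + K * Q n w) ->
  (\int[P]_w p (V n w)) @[n --> \oo] --> l ->
  (\int[P]_w p (U n w)) @[n --> \oo] --> l.
Proof.
move=> [p1 [p2 [C tp]]] mU mV iQ Q0 UV Vl.
have [C0 b lip _] := tp.
have pUV n w : `|p (U n w) - p (V n w)| <= 2 * C * Num.min 1 `|U n w - V n w|.
  have [h|h] := leP 1 `|U n w - V n w|.
    have [b1 _ _] := b (U n w); have [b2 _ _] := b (V n w).
    by rewrite mulr1 (le_trans (ler_normB _ _))//; lra.
  have [l0 _ _] := lip (U n w) (V n w).
  rewrite (le_trans l0)// ler_wpM2r//.
  by rewrite -[leLHS]mul1r ler_wpM2r//; lra.
apply/cvgrPdist_le => e e0.
pose e1 := e / (8 * (C + 1)).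
have C1 : 0 < C + 1 by rewrite ltr_wpDl.
have e10 : 0 < e1 by rewrite divr_gt0// mulr_gt0.
have e1E : (C + 1) * e1 = e / 8 by rewrite /e1; field; rewrite gt_eqF.
have [K HK] := UV _ e10.
have bound n : `|\int[P]_w p (U n w) - \int[P]_w p (V n w)| <=
    2 * C * (e1 + K * \int[P]_w Q n w).
  have [i1 _ _] := taylor2_intble P tp (mU n).
  have [i2 _ _] := taylor2_intble P tp (mV n).
  have i3 := intbleZ K (iQ n).
  have i4 := intbleD (intble_cst P e1) i3.
  have -> : 2 * C * (e1 + K * \int[P]_w Q n w) =
      \int[P]_w (2 * C * (e1 + K * Q n w)).
    rewrite RintegralZl// RintegralD//; last exact: intble_cst.
    by rewrite Rint_cst RintegralZl.
  apply: Rint_dist => //; first exact: intbleZ.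
  move=> w; rewrite (le_trans (pUV n w))// ler_wpM2l ?HK//.
  by rewrite mulr_ge0.
have KQ : (2 * C * K * \int[P]_w Q n w) @[n --> \oo] --> (0 : R).
  rewrite -[X in _ --> X](mulr0 (2 * C * K)).
  by apply: cvgM; [exact: cvg_cst|exact: Q0].
have /cvgrPdist_le/(_ (e / 4)) KQe := KQ.
have /cvgrPdist_le/(_ (e / 4)) Vle := Vl.
have e40 : 0 < e / 4 by rewrite divr_gt0.
near=> n.
have h1 : `|0 - 2 * C * K * \int[P]_w Q n w| <= e / 4 by near: n; exact: KQe.
have h2 : `|l - \int[P]_w p (V n w)| <= e / 4 by near: n; exact: Vle.
have h3 := bound n.
rewrite (le_trans (ler_distD (\int[P]_w p (V n w)) _ _))//.
rewrite [X in _ + X]distrC.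
have {}h3 : `|\int[P]_w p (U n w) - \int[P]_w p (V n w)| <=
    2 * (C * e1) + 2 * C * K * \int[P]_w Q n w.
  by rewrite (le_trans h3)// le_eqVlt; apply/orP; left; apply/eqP; ring.
have h4 : C * e1 <= e / 8 by rewrite -e1E ler_wpM2r ?ltW// ltrDl.
move: h1; rewrite sub0r normrN => h1.
have h5 := le_trans (ler_norm _) h1.
move: h2 h3 h4 h5; move: (2 * C * K * _) (C * e1) => u v h2 h3 h4 h5.
by lra.
Unshelve. all: by end_near. Qed.

End slutsky.

Section ratio.
Context (R : realType).

(** With [w = q * (V - D)], the difference is [t / D + e * w / (V * D)]: each term is
    quadratic in quantities that are at most [dl]. *)
Lemma ratio_remainder (V Kt eps : R) : 0 < V -> 0 <= Kt -> 0 < eps ->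
  exists2 dl, 0 < dl & forall q a b c e t : R, 1 <= q ->
    `|a| <= dl -> `|b| <= dl -> `|c| <= dl -> `|e| <= dl ->
    `|t| <= Kt * (a ^+ 2 + b ^+ 2) ->
    let D := V + c / q - (a / q) ^+ 2 in
    D != 0 /\ `|(q * e + t) / D - q * e / V| <= eps.
Proof.
move=> V0 Kt0 eps0.
(* below, the two terms of the remainder are at most [dl * (4 * Kt / V)] and
   [dl * (4 / V ^+ 2)] *)
pose M := 4 * Kt / V + 4 / V ^+ 2.
have M0 : 0 < M.
  by rewrite ltr_wpDl ?divr_ge0 ?mulr_ge0 ?(ltW V0)// divr_gt0// exprn_gt0.
pose dl := Num.min 1 (Num.min (V / 4) (eps / M)).
have dl0 : 0 < dl by rewrite !lt_min ltr01 !divr_gt0.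
have dl1 : dl <= 1 by rewrite ge_min lexx.
have dlV : dl <= V / 4 by rewrite !ge_min lexx orbT.
have dlM : dl * M <= eps by rewrite -ler_pdivlMr// !ge_min lexx !orbT.
exists dl => // q a b c e t q1 a1 b1 c1 e1 t1 D.
have q0 : 0 < q by rewrite (lt_le_trans ltr01).
have sq (x : R) : `|x| <= dl -> x ^+ 2 <= dl.
  move=> xd; rewrite -real_normK ?num_real// expr2.
  rewrite (@le_trans _ _ (dl * 1))//; last by rewrite mulr1.
  by rewrite ler_pM// (le_trans xd).
have iq : 0 <= q^-1 <= 1 by rewrite invr_ge0 (ltW q0)/= invf_le1.
(* q times the error of the denominator *)
pose w := - c + a ^+ 2 / q.
have w1 : `|w| <= 2 * dl.
  rewrite (le_trans (ler_normD _ _))// normrN mulr_natl mulr2n lerD//.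
  rewrite normrM ger0_norm ?sqr_ge0// ger0_norm; last by case/andP: iq.
  rewrite (@le_trans _ _ (a ^+ 2 * 1))//; last by rewrite mulr1 sq.
  by rewrite ler_wpM2l ?sqr_ge0//; case/andP: iq.
have DE : D = V - w / q by rewrite /D /w; field; rewrite gt_eqF.
have wq : `|w / q| <= V / 2.
  rewrite normrM [X in _ * X]ger0_norm; last by case/andP: iq.
  rewrite (@le_trans _ _ (2 * dl * 1))//; last by rewrite mulr1; lra.
  by rewrite ler_pM// ; case/andP: iq.
have DV : V / 2 <= D by move: wq => /ler_normlP[]; rewrite DE; lra.
have D0 : 0 < D by rewrite (lt_le_trans _ DV)// divr_gt0.
split; first by rewrite gt_eqF.
have -> : (q * e + t) / D - q * e / V = t / D + e * w / (V * D).
  have wE : w = q * (V - D) by rewrite DE; field; rewrite gt_eqF.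
  by rewrite wE; field; rewrite !gt_eqF.
have iD : D^-1 <= 2 / V by rewrite -invf_div lef_pV2 ?posrE// divr_gt0.
have iD0 : 0 <= D^-1 by rewrite invr_ge0 ltW.
apply: le_trans dlM; rewrite /M [leRHS]mulrDr (le_trans (ler_normD _ _))//.
apply: lerD.
  rewrite normrM (ger0_norm iD0).
  rewrite (@le_trans _ _ ((Kt * (dl + dl)) * (2 / V)))//.
    rewrite ler_pM// (le_trans t1)// ler_wpM2l// lerD//; exact: sq.
  by rewrite le_eqVlt; apply/orP; left; apply/eqP; field; rewrite gt_eqF.
rewrite !normrM normfV normrM (gtr0_norm V0) (gtr0_norm D0) invfM.
rewrite (@le_trans _ _ (1 * (2 * dl) * (V^-1 * (2 / V))))//.
  rewrite ler_pM ?mulr_ge0 ?invr_ge0 ?(ltW V0) ?(ltW D0)//.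
    by rewrite ler_pM// (le_trans e1).
  by rewrite ler_wpM2l// invr_ge0 ltW.
by rewrite le_eqVlt; apply/orP; left; apply/eqP; field; rewrite gt_eqF.
Qed.

End ratio.

Section ratio_clt.
Context d (T : measurableType d) (R : realType) (P : probability T R).
Context d1 (T1 : measurableType d1).
Variables (W : nat -> T -> T1) (mW : forall i, measurable_fun setT (W i)).
Variables (W0 : T -> T1) (mW0 : measurable_fun setT W0).
Hypothesis iW : iid_copies P W W0.

Definition centered_sqint (k : T1 -> R) := [/\ measurable_fun setT k,
  sqint P (fun w => k (W0 w)) & \int[P]_w k (W0 w) = 0].

Local Notation avg k n w := (emp_mean n (fun i => k (W i w))).

Let q n : R := Num.sqrt (Num.sqrt n.+1%:R).

Let q1 n : 1 <= q n.
Proof. by rewrite -[leLHS]sqrtr1 ler_wsqrtr// -[leLHS]sqrtr1 ler_wsqrtr// ler1n. Qed.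

Let q2 n : q n ^+ 2 = Num.sqrt n.+1%:R.
Proof. by rewrite sqr_sqrtr ?sqrtr_ge0. Qed.

(** By [iid_sum_sqr] the mean square is [E k^2 / sqrt n.+1]. *)
Lemma scaled_mean_sqr k : centered_sqint k ->
  (forall n, intble P (fun w => (q n * avg k n.+1 w) ^+ 2)) /\
  (\int[P]_w (q n * avg k n.+1 w) ^+ 2) @[n --> \oo] --> (0 : R).
Proof.
move=> [mk k2 k0].
have H n := iid_sum_sqr mW mW0 iW mk k2 k0 n.+1.
have E n w : (q n * avg k n.+1 w) ^+ 2 =
   (q n / n.+1%:R) ^+ 2 * (\sum_(i < n.+1) k (W i w)) ^+ 2.
  by rewrite /emp_mean; ring.
split=> [n|].
  under eq_fun do rewrite E.
  by apply: intbleZ; have [[]] := H n.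
have -> : (fun n => \int[P]_w (q n * avg k n.+1 w) ^+ 2) =
    (fun n => (\int[P]_w k (W0 w) ^+ 2) * (Num.sqrt n.+1%:R)^-1).
  apply/funext => n; under eq_Rintegral do rewrite E.
  have [[_ i2] I2] := H n.
  rewrite RintegralZl// I2 exprMn q2.
  have s0 : Num.sqrt n.+1%:R != 0 :> R by rewrite gt_eqF// sqrtr_gt0.
  have NE : n.+1%:R = Num.sqrt n.+1%:R ^+ 2 :> R by rewrite sqr_sqrtr.
  move: (Num.sqrt n.+1%:R) s0 NE => s s0 ->.
  by field.
have s0 : (Num.sqrt n.+1%:R)^-1 @[n --> \oo] --> (0 : R).
  exact: cvg_inv_sqrt.
rewrite -[X in _ --> X](mulr0 (\int[P]_w k (W0 w) ^+ 2)).
by apply: cvgM; [exact: cvg_cst|exact: s0].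
Qed.

(** The estimator is compared with [sqrt n.+1 * A kE / V], to which the central limit
    theorem applies.  If all four scaled means are at most [dl], the difference
    is at most [e] by [ratio_remainder]; otherwise the sum of their squares
    exceeds [dl ^+ 2], and its expectation tends to 0. *)
Lemma ratio_clt (kA kB kC kE : T1 -> R) (V S Kt : R) (est : nat -> T -> R) :
  centered_sqint kA -> centered_sqint kB -> centered_sqint kC ->
  centered_sqint kE -> 0 < V -> 0 <= Kt ->
  (forall n, measurable_fun setT (est n)) ->
  (forall n w, let D := V + avg kC n.+1 w - avg kA n.+1 w ^+ 2 in D != 0 ->
    exists2 t, `|t| <= Kt * (avg kA n.+1 w ^+ 2 + avg kB n.+1 w ^+ 2) &
      est n.+1 w - S = (avg kE n.+1 w + t) / D) ->
  cvg_in_distribution P (fun N w => Num.sqrt N%:R * (est N w - S))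
    (gaussian 0 ((\int[P]_w kE (W0 w) ^+ 2) / V ^+ 2)).
Proof.
move=> hA hB hC hE V0 Kt0 mest Hest.
set v := _ / V ^+ 2.
have v0 : 0 <= v.
  by rewrite divr_ge0 ?sqr_ge0//; apply: Rintegral_ge0 => w _; exact: sqr_ge0.
pose s := Num.sqrt v.
have s2 : s ^+ 2 = v by rewrite sqr_sqrtr.
apply: cvg_in_distribution_taylor.
  by move=> n; apply: measurable_funM => //; exact: measurable_funB.
move=> p tp; rewrite -s2 integral_gaussian0 ?sqrtr_ge0//.
rewrite -(cvg_shiftS (fun n => \int[P]_w p (Num.sqrt n%:R * (est n w - S)))).
pose kF (x : T1) := V^-1 * kE x.
have [mE E2 E0] := hE.
have mF : measurable_fun setT kF by exact: measurable_funM.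
have F2 : sqint P (fun w => kF (W0 w)) := sqintZ V^-1 E2.
have F0 : \int[P]_w kF (W0 w) = 0.
  by rewrite RintegralZl ?E0 ?mulr0//; exact: sqint_intble.
have FV : s ^+ 2 = \int[P]_w kF (W0 w) ^+ 2.
  rewrite s2 /v mulrC -exprVn -RintegralZl//; last exact: E2.2.
  by apply: eq_Rintegral => w _; rewrite exprMn.
have clt := central_limit_taylor mW mW0 iW mF F2 F0 (sqrtr_ge0 _) FV tp.
have mavg k n : measurable_fun setT k -> measurable_fun setT (fun w => avg k n w).
  by move=> mk; apply: measurable_funM => //; exact: (measurable_prefix_sum mW mk n).
have [iA cA] := scaled_mean_sqr hA; have [iB cB] := scaled_mean_sqr hB.
have [iC cC] := scaled_mean_sqr hC; have [iE cE] := scaled_mean_sqr hE.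
pose sq k n w := (q n * avg k n.+1 w) ^+ 2.
apply: (@slutsky_taylor _ _ _ P p _ _
  (fun n w => sq kA n w + sq kB n w + (sq kC n w + sq kE n w)) _ tp _ _ _ _ _ clt).
- by move=> n; apply: measurable_funM => //; exact: measurable_funB.
- by move=> n; apply: measurable_funM => //; exact: (measurable_prefix_sum mW mF).
- by move=> n; apply: intbleD; apply: intbleD; [exact: iA|exact: iB|exact: iC|exact: iE].
- have -> : (fun n => \int[P]_w (sq kA n w + sq kB n w + (sq kC n w + sq kE n w))) =
    (fun n => (\int[P]_w sq kA n w + \int[P]_w sq kB n w) +
        (\int[P]_w sq kC n w + \int[P]_w sq kE n w)).
    apply/funext => n; rewrite RintegralD//; last 2 first.
    + by apply: intbleD; [exact: iA|exact: iB].
    + by apply: intbleD; [exact: iC|exact: iE].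
    by rewrite (RintegralD measurableT (iA n) (iB n))
      (RintegralD measurableT (iC n) (iE n)).
  rewrite -[X in _ --> X](addr0 0) -[X in _ --> X + _](addr0 0).
  rewrite -[X in _ --> _ + X](addr0 0).
  by apply: (@cvgD _ R^o); apply: (@cvgD _ R^o); [exact: cA|exact: cB|exact: cC|exact: cE].
move=> e e0.
have [dl dl0 Hdl] := ratio_remainder V0 Kt0 e0.
exists (dl ^+ 2)^-1 => n w.
have q0 : 0 < q n by rewrite (lt_le_trans ltr01)// q1.
have qn0 : q n != 0 by rewrite gt_eqF.
pose a k := q n * avg k n.+1 w.
have sqa k : sq k n w = a k ^+ 2 by [].
set X := _ + (sq kC n w + sq kE n w).
have far k : a k ^+ 2 <= X -> dl < `|a k| -> 1 <= e + (dl ^+ 2)^-1 * X.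
  move=> kX h; rewrite (@le_trans _ _ ((dl ^+ 2)^-1 * a k ^+ 2))//.
    rewrite mulrC ler_pdivlMr ?exprn_gt0// mul1r -(real_normK (num_real (a k))).
    by rewrite lerXn2r ?nnegrE// ltW.
  rewrite (@le_trans _ _ ((dl ^+ 2)^-1 * X))//.
    by rewrite ler_wpM2l ?invr_ge0 ?sqr_ge0.
  by rewrite lerDr ltW.
have XA : a kA ^+ 2 <= X by rewrite /X -addrA lerDl !addr_ge0 ?sqr_ge0.
have XB : a kB ^+ 2 <= X.
  by rewrite /X (addrC (sq kA n w)) -addrA lerDl !addr_ge0 ?sqr_ge0.
have XC : a kC ^+ 2 <= X.
  by rewrite /X addrC -addrA lerDl !addr_ge0 ?sqr_ge0.
have XE : a kE ^+ 2 <= X.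
  by rewrite /X addrA lerDr !addr_ge0 ?sqr_ge0.
have Q0 : 0 <= (dl ^+ 2)^-1 * X.
  by rewrite mulr_ge0 ?invr_ge0 ?sqr_ge0// (le_trans _ XA) ?sqr_ge0.
rewrite ge_min.
have [hAl|/(far _ XA) ->//] := leP `|a kA| dl.
have [hBl|/(far _ XB) ->//] := leP `|a kB| dl.
have [hCl|/(far _ XC) ->//] := leP `|a kC| dl.
have [hEl|/(far _ XE) ->//] := leP `|a kE| dl.
apply/orP; right; rewrite (@le_trans _ _ e)//; last by rewrite lerDl.
have cq : a kC / q n = avg kC n.+1 w by rewrite /a; field.
have aq : a kA / q n = avg kA n.+1 w by rewrite /a; field.
have bq : a kB / q n = avg kB n.+1 w by rewrite /a; field.
pose D := V + avg kC n.+1 w - avg kA n.+1 w ^+ 2.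
have D0 : D != 0.
  have [] := Hdl (q n) (a kA) (a kB) (a kC) (a kE) 0 (q1 n) hAl hBl hCl hEl _.
    by rewrite normr0 mulr_ge0// addr_ge0// sqr_ge0.
  by rewrite cq aq.
have [t ht tE] := Hest n w D0.
have [] := Hdl (q n) (a kA) (a kB) (a kC) (a kE) (q n ^+ 2 * t) (q1 n) hAl hBl hCl hEl _.
  have aE k : a k ^+ 2 = q n ^+ 2 * avg k n.+1 w ^+ 2 by rewrite /a exprMn.
  rewrite normrM ger0_norm ?sqr_ge0// !aE -mulrDr mulrCA.
  by rewrite ler_wpM2l ?sqr_ge0.
move=> _; rewrite cq aq -/D => H.
rewrite (le_trans _ H)// le_eqVlt; apply/orP; left; apply/eqP; congr `|_|.
rewrite tE -/D -q2; congr (_ - _).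
  by rewrite /a; field.
rewrite /kF -mulr_sumr /a /emp_mean.
have NE : n.+1%:R = q n ^+ 2 ^+ 2 :> R by rewrite q2 sqr_sqrtr.
rewrite NE; move: (q n) qn0 => z z0.
by field; rewrite z0 gt_eqF.
Qed.

End ratio_clt.

(** * Conditional expectations and the Sobol index *)

Section sobol.
Context d (T : measurableType d) (R : realType) (P : probability T R).
Context d1 d2 (T1 : measurableType d1) (T2 : measurableType d2).

Lemma meanE (Y : T -> R) : mean P Y = \int[P]_w Y w.
Proof. by rewrite /mean unlock. Qed.

Lemma varE (Y : T -> R) : var P Y = \int[P]_w (Y w - \int[P]_w Y w) ^+ 2.
Proof.
by rewrite /var /variance unlock unlock; apply: eq_Rintegral => w _;
  rewrite /= expr2.
Qed.

Lemma Rintegral_indic_sub_eq0 (f g : T -> R) (A : set T) : measurable A ->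
  intble P f -> intble P g ->
  (\int[P]_(w in A) (f w)%:E = \int[P]_(w in A) (g w)%:E)%E ->
  \int[P]_w (\1_A w * (f w - g w)) = 0.
Proof.
move=> mA if1 ig1 E.
have ifA : P.-integrable A (EFin \o f) by apply: integrableS if1.
have igA : P.-integrable A (EFin \o g) by apply: integrableS ig1.
transitivity (\int[P]_(w in A) (f w - g w)).
  rewrite [RHS]Rintegral_mkcond; apply: eq_Rintegral => w _.
  by rewrite patchE indicE; case: ifP; rewrite ?mul1r ?mul0r.
by rewrite RintegralB// /Rintegral E subrr.
Qed.

(** The event [C2 < C1] belongs to the sigma-algebra of [X], so [C1] and [C2] have the
    same integral over it, although [C1 - C2] is positive there. *)
Lemma cond_expectation_le (X : T -> T1) (Y C1 C2 : T -> R) :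
  measurable_fun setT X ->
  is_cond_expectation P X Y C1 -> is_cond_expectation P X Y C2 ->
  {ae P, forall w, C1 w <= C2 w}.
Proof.
move=> mX [m1 i1 H1] [m2 i2 H2].
pose A := [set w | C2 w < C1 w].
have GA : g_sigma_algebra_preimage X A.
  have : @measurable_fun _ _ (g_sigma_algebra_preimageType X) _ setT
      (fun w => C2 w < C1 w).
    exact: measurable_fun_ltr.
  move=> /(_ measurableT [set true] I); rewrite setTI.
  by rewrite (_ : _ @^-1` _ = A)//; apply/seteqP; split => w.
have mA : measurable A.
  by have [B mB <-] := GA; exact: mX.
have E : \int[P]_w (\1_A w * (C1 w - C2 w)) = 0.
  by apply: Rintegral_indic_sub_eq0 => //; rewrite H1// H2.
pose h w := \1_A w * (C1 w - C2 w).
have h0 w : 0 <= h w.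
  rewrite /h indicE; case: (boolP (w \in A)) => [|_]; last by rewrite mul0r.
  by rewrite inE /A/= => /ltW ?; rewrite mul1r subr_ge0.
have mh : measurable_fun setT h.
  apply: measurable_funM; first exact: measurable_indic.
  by apply: measurable_funB; [exact: intble_measurable i1|exact: intble_measurable i2].
have ih : intble P h.
  apply: (intble_dom mh _ (intbleD (integrable_norm i1) (integrable_norm i2))).
  move=> w; rewrite /h normrM (le_trans _ (ler_normB _ _))//.
  by rewrite ler_piMl// indicE; case: (_ \in _); rewrite ?normr1 ?normr0.
have : ae_eq P setT (EFin \o h) (cst 0%E).
  apply/ae_eq_integral_abs => //; first exact/measurable_EFinP.
  rewrite (eq_integral (EFin \o h)); last by move=> w _ /=; rewrite ger0_norm.
  rewrite -[LHS]fineK; last exact: integrable_fin_num.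
  by rewrite -/(Rintegral _ _ _) E.
apply: filterS => w /(_ I)/= [hw]; rewrite leNgt; apply/negP => wA.
have : h w = C1 w - C2 w by rewrite /h indicE mem_set// mul1r.
by rewrite hw => /esym/eqP; rewrite subr_eq0 gt_eqF.
Qed.

Lemma cond_expectation_ae_eq (X : T -> T1) (Y C1 C2 : T -> R) :
  measurable_fun setT X ->
  is_cond_expectation P X Y C1 -> is_cond_expectation P X Y C2 ->
  {ae P, forall w, C1 w = C2 w}.
Proof.
move=> mX h1 h2.
have := cond_expectation_le mX h1 h2; have := cond_expectation_le mX h2 h1.
by apply: filterS2 => w a b; apply/eqP; rewrite eq_le a b.
Qed.

Lemma var_cond_expectation (X : T -> T1) (Y C : T -> R) :
  measurable_fun setT X -> is_cond_expectation P X Y C ->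
  var P (cond_expectation P X Y) = var P C.
Proof.
move=> mX hC.
have hX : is_cond_expectation P X Y (cond_expectation P X Y).
  exact: (@xgetI _ (cst 0) [set C | is_cond_expectation P X Y C] C).
have ae := cond_expectation_ae_eq mX hX hC.
have [_ i1 _] := hX; have [_ i2 _] := hC.
have m1 := intble_measurable i1; have m2 := intble_measurable i2.
have E : \int[P]_w cond_expectation P X Y w = \int[P]_w C w.
  rewrite /Rintegral; congr fine; apply: ae_eq_integral => //.
  - exact/measurable_EFinP.
  - exact/measurable_EFinP.
  - by apply: filterS ae => w /= -> _.
rewrite !varE E /Rintegral; congr fine; apply: ae_eq_integral => //.
- by apply/measurable_EFinP/measurable_funX; exact: measurable_funB.
- by apply/measurable_EFinP/measurable_funX; exact: measurable_funB.
- by apply: filterS ae => w /= -> _.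
Qed.

Lemma independent_same_law_pair (U : T -> T1) (V V' : T -> T2) :
  measurable_fun setT U -> measurable_fun setT V -> measurable_fun setT V' ->
  independent P U V -> independent P U V' -> same_law P V V' ->
  same_law P (fun w => (U w, V w)) (fun w => (U w, V' w)).
Proof.
move=> mU mV mV' UV UV' VV' A mA.
have mUV := measurable_fun_pair mU mV; have mUV' := measurable_fun_pair mU mV'.
have key (V1 : T -> T2) (mV1 : measurable_fun setT V1) : independent P U V1 ->
    (\int[P]_w (\1_A (U w, V1 w))%:E = \int[P]_w \int[P]_w' (\1_A (U w, V1 w'))%:E)%E.
  move=> i; apply: (@ge0_independent_integral _ _ _ _ _ _ _ _ U V1 (fun x => (\1_A x)%:E)) => //.
  exact/measurable_EFinP/measurable_indic.
have ind (V1 : T -> T2) (mV1 : measurable_fun setT V1) :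
    (P ((fun w => (U w, V1 w)) @^-1` A) = \int[P]_w (\1_A (U w, V1 w))%:E)%E.
  have mpre : measurable ((fun w => (U w, V1 w)) @^-1` A).
    rewrite -[X in measurable X]setTI; exact: (measurable_fun_pair mU mV1).
  by rewrite -(setIT (_ @^-1` _)) -integral_indic.
rewrite (ind V mV) (ind V' mV') (key V mV UV) (key V' mV' UV').
apply: eq_integral => w _.
apply: (@same_law_integral _ _ _ _ _ _ V V' (fun x => (\1_A (U w, x))%:E)) => //.
apply/measurable_EFinP; apply: (measurableT_comp (measurable_indic mA)).
exact: measurable_pair1.
Qed.

End sobol.

Section sobol_variance.
Context d (T : measurableType d) (R : realType) (P : probability T R).
Context d1 d2 (T1 : measurableType d1) (T2 : measurableType d2).
Variables (X : T -> T1) (Z Z' : T -> T2) (f : T1 * T2 -> R).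
Hypotheses (mX : measurable_fun setT X) (mZ : measurable_fun setT Z)
  (mZ' : measurable_fun setT Z') (mf : measurable_fun setT f).
Hypotheses (XZ : independent P X Z) (ZZ : same_law P Z' Z)
  (Z'XZ : independent P Z' (fun w => (X w, Z w))).

Lemma independent_X_copy : independent P X Z'.
Proof.
move=> A B mA mB.
have mA' : measurable ((fst : T1 * T2 -> T1) @^-1` A).
  by rewrite -[X in measurable X]setTI; exact: measurable_fst.
have := Z'XZ mB mA'.
by rewrite setIC muleC.
Qed.

Lemma copy_same_law : same_law P (fun w => (X w, Z' w)) (fun w => (X w, Z w)).
Proof. exact: independent_same_law_pair independent_X_copy XZ ZZ. Qed.

Hypothesis Y2 : sqint P (fun w => f (X w, Z w)).
Let m := \int[P]_w f (X w, Z w).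
Let g (x : T1 * T2) := f x - m.
Let c (x : T1) := \int[P]_w g (x, Z w).

Let mg : measurable_fun setT g.
Proof. exact: measurable_funB. Qed.

Let g2 : sqint P (fun w => g (X w, Z w)).
Proof. exact: sqintB Y2 (sqint_cst P m). Qed.

Let mXZ := measurable_fun_pair mX mZ.
Let mXZ' := measurable_fun_pair mX mZ'.

Let g2' : sqint P (fun w => g (X w, Z' w)).
Proof.
split; first exact: measurableT_comp.
apply: (@same_law_integrable _ _ _ _ _ _ _ _ (fun x => g x ^+ 2) mXZ' mXZ copy_same_law).
  exact: measurable_funX.
exact: g2.2.
Qed.

Let mgx x : measurable_fun setT (fun z => g (x, z)).
Proof. by apply: measurableT_comp => //; exact: measurable_pair1. Qed.

Let mgxZ x : measurable_fun setT (fun w => g (x, Z w)).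
Proof. by apply: (measurableT_comp (mgx x)). Qed.

Let mc : measurable_fun setT c.
Proof.
have mE : measurable_fun setT (fun xw : T1 * T => (g (xw.1, Z xw.2))%:E).
  apply/measurable_EFinP; apply: (measurableT_comp mg).
  by apply: measurable_fun_pair => //; exact: measurableT_comp.
apply: measurableT_comp => //.
rewrite (_ : (fun x => _) = (fun x =>
    \int[P]_w ((fun xw : T1 * T => (g (xw.1, Z xw.2))%:E)^\+ (x, w)) -
    \int[P]_w ((fun xw : T1 * T => (g (xw.1, Z xw.2))%:E)^\- (x, w)))%E).
  apply: emeasurable_funB.
  - by apply: measurable_fun_fubini_tonelli_F => //; exact: measurable_funepos.
  - by apply: measurable_fun_fubini_tonelli_F => //; exact: measurable_funeneg.
apply/funext => x; rewrite integralE; congr (_ - _)%E;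
  by apply: eq_integral => w _; rewrite !unlock.
Qed.

(* averaging Z out while X, hence any u (X), is held fixed *)
Let factor (u : T1 -> R) : measurable_fun setT u ->
  intble P (fun w => u (X w) * g (X w, Z w)) ->
  intble P (fun w => u (X w) * c (X w)) /\
  \int[P]_w (u (X w) * g (X w, Z w)) = \int[P]_w (u (X w) * c (X w)).
Proof.
move=> mu iug.
have mh : measurable_fun setT (fun xz : T1 * T2 => u xz.1 * g xz).
  by apply: measurable_funM => //; exact: measurableT_comp.
have [i1 ->] := @independent_Rintegral _ _ _ _ _ _ _ _ _ _
  (fun xz : T1 * T2 => u xz.1 * g xz) mX mZ XZ mh iug.
have E w : \int[P]_w' (u (X w) * g (X w, Z w')) = u (X w) * c (X w).
  by rewrite Rint_scale.
split; last by apply: eq_Rintegral => w _; rewrite E.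
by apply: eq_integrable i1 => // w _; rewrite /= E.
Qed.

Let C w := m + c (X w).

Let ic : intble P (fun w => c (X w)).
Proof.
have := (@factor (fun=> 1) (measurable_cst _)).
have i1 : intble P (fun w => 1 * g (X w, Z w)).
  by under eq_fun do rewrite mul1r; exact: sqint_intble.
by move=> /(_ i1)[+ _]; under eq_fun do rewrite mul1r.
Qed.

Let cond_expectation_C : is_cond_expectation P X (fun w => f (X w, Z w)) C.
Proof.
have mC : measurable_fun setT (fun x => m + c x) by exact: measurable_funD.
split.
- move=> _ B mB; rewrite setTI; exists ((fun x => m + c x) @^-1` B) => //.
    by rewrite -[X in measurable X]setTI; exact: mC.
  by rewrite setTI.
- exact: intbleD (intble_cst _ _) ic.
- move=> _ [B mB <-]; rewrite setTI.
  have mA : measurable (X @^-1` B) by rewrite -[X in measurable X]setTI; exact: mX.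
  have iY := sqint_intble Y2.
  have iC : intble P C := intbleD (intble_cst _ _) ic.
  have mu1 : measurable_fun setT (\1_B : T1 -> R) by exact: measurable_indic.
  have ig : intble P (fun w => \1_B (X w) * g (X w, Z w)).
    apply: (intble_dom _ _ (integrable_norm (sqint_intble g2))).
      apply: measurable_funM; first exact: measurableT_comp.
      exact: measurableT_comp.
    move=> w; rewrite normrM ler_piMl// indicE.
    by case: (_ \in _); rewrite ?normr1 ?normr0.
  have [i1 E] := factor mu1 ig.
  have i0 : intble P (fun w => m * \1_B (X w)).
    apply: (@intble_bounded _ _ _ _ _ `|m|).
      by apply: measurable_funM => //; exact: measurableT_comp.
    move=> w; rewrite normrM ler_piMr// indicE.
    by case: (_ \in _); rewrite ?normr1 ?normr0.
  have conv (h h' : T -> R) : intble P h -> (forall w, h w = m + h' w) ->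
      intble P (fun w => \1_B (X w) * h' w) ->
      (\int[P]_(w in X @^-1` B) (h w)%:E = (\int[P]_w (m * \1_B (X w)) +
        \int[P]_w (\1_B (X w) * h' w))%:E)%E.
    move=> ih hh' ih'.
    rewrite -[LHS]fineK; last first.
      by apply: integrable_fin_num => //; exact: integrableS ih.
    congr EFin; rewrite -/(Rintegral _ _ _) Rintegral_mkcond -RintegralD//.
    apply: eq_Rintegral => w _; rewrite patchE indicE hh'.
    rewrite (_ : (w \in X @^-1` B) = (X w \in B))//.
    by case: ifP => _; rewrite ?mul1r ?mul0r ?mulr1 ?mulr0 ?addr0.
  rewrite (conv C (fun w => c (X w)))// (conv _ (fun w => g (X w, Z w)))//.
    by rewrite E.
  by move=> w; rewrite /g addrC subrK.
Qed.

(** With [g = f - m] and [c x = E (g (x, Z))], the variable [m + c X] is a version of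
    the conditional expectation.  Averaging [Z'] out turns [E (g (X, Z) g (X, Z'))]
    into [E (g (X, Z) c X)], and averaging [Z] out gives [E (c X)^2]. *)
Lemma sobol_var : var P (cond_expectation P X (fun w => f (X w, Z w))) =
  \int[P]_w ((f (X w, Z w) - m) * (f (X w, Z' w) - m)).
Proof.
rewrite (var_cond_expectation mX cond_expectation_C) varE.
have c0 : \int[P]_w c (X w) = 0.
  have := (@factor (fun=> 1) (measurable_cst _)).
  have i1 : intble P (fun w => 1 * g (X w, Z w)).
    by under eq_fun do rewrite mul1r; exact: sqint_intble.
  move=> /(_ i1)[_]; under eq_Rintegral do rewrite mul1r.
  under [in X in _ = X -> _]eq_Rintegral do rewrite mul1r.
  move=> <-; rewrite RintegralB//; [|exact: sqint_intble Y2|exact: intble_cst].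
  by rewrite Rint_cst subrr.
have CE : \int[P]_w C w = m.
  by rewrite RintegralD// ?c0 ?addr0 ?Rint_cst//; exact: intble_cst.
rewrite CE.
have ZXZ' : independent P (fun w => (X w, Z w)) Z'.
  by move=> A B mA mB; rewrite setIC Z'XZ// muleC.
have mh : measurable_fun setT
    (fun a : (T1 * T2) * T2 => g a.1 * g (a.1.1, a.2)).
  apply: measurable_funM; first exact: measurableT_comp.
  apply: (measurableT_comp mg); apply: measurable_fun_pair => //.
  exact: measurableT_comp.
have [i1 ->] := @independent_Rintegral _ _ _ _ _ _ _ _ _ _
  (fun a : (T1 * T2) * T2 => g a.1 * g (a.1.1, a.2)) mXZ mZ' ZXZ' mh
  (sqint_mul g2 g2').
have E w : \int[P]_w' (g (X w, Z w) * g (X w, Z' w')) = c (X w) * g (X w, Z w).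
  rewrite Rint_scale; last exact: (measurableT_comp (mgx (X w)) mZ').
  rewrite mulrC; congr (_ * _); rewrite /c /Rintegral; congr fine.
  apply: (@same_law_integral _ _ _ _ _ _ Z' Z (fun z => (g (X w, z))%:E)) => //.
  exact/measurable_EFinP.
rewrite /= in i1.
have i2 : intble P (fun w => c (X w) * g (X w, Z w)).
  by apply: eq_integrable i1 => // w _; rewrite /= E.
transitivity (\int[P]_w (c (X w) * c (X w))).
  by apply: eq_Rintegral => w _; rewrite /C addrC addKr expr2.
have [_ <-] := factor mc i2.
by apply: eq_Rintegral => w _; rewrite E.
Qed.

End sobol_variance.

(** * The estimation errors as ratios of empirical means *)

Section estimator_algebra.
Context (R : realType).
Implicit Types (u v : nat -> R) (c m V S : R).

(** All the empirical means in the estimators are of this form after centering. *)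
Lemma emp_mean_quadratic n u v (a0 a1 a2 a11 a12 a22 : R) :
  emp_mean n.+1 (fun i => a0 + a1 * u i + a2 * v i + a11 * u i ^+ 2 +
    a12 * (u i * v i) + a22 * v i ^+ 2) =
  a0 + a1 * emp_mean n.+1 u + a2 * emp_mean n.+1 v +
    a11 * emp_mean n.+1 (fun i => u i ^+ 2) +
    a12 * emp_mean n.+1 (fun i => u i * v i) +
    a22 * emp_mean n.+1 (fun i => v i ^+ 2).
Proof.
rewrite /emp_mean !big_split/= -!mulr_sumr sumr_const card_ord.
have N0 : n.+1%:R != 0 :> R by rewrite pnatr_eq0.
rewrite -[a0 *+ _]mulr_natr; move: (n.+1%:R) N0 => N N0.
by field.
Qed.

Lemma sobol_S_error c m V S n u v :
  let y i := u i - m in let z i := v i - m in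
  let A := @emp_mean R n.+1 in
  let D := V + A (fun i => y i ^+ 2 - V) - A y ^+ 2 in
  D != 0 ->
  sobol_S c n.+1 u v - S =
  (A (fun i => y i * (z i - S * y i)) + (S * A y ^+ 2 - A y * A z)) / D.
Proof.
move=> y z A D D0.
have uE i : u i = y i + m by rewrite /y subrK.
have vE i : v i = z i + m by rewrite /z subrK.
have q k a0 a1 a2 a11 a12 a22 B : (forall i, k i = a0 + a1 * y i + a2 * z i +
    a11 * y i ^+ 2 + a12 * (y i * z i) + a22 * z i ^+ 2) ->
    a0 + a1 * A y + a2 * A z + a11 * A (fun i => y i ^+ 2) +
    a12 * A (fun i => y i * z i) + a22 * A (fun i => z i ^+ 2) = B ->
    A k = B.
  move=> h <-; rewrite /A -emp_mean_quadratic; congr (emp_mean _ _).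
  exact/funext.
have Eu : A u = m + A y.
  by apply: (q _ m 1 0 0 0 0) => [i|]; [rewrite uE; ring|ring].
have Ev : A v = m + A z.
  by apply: (q _ m 0 1 0 0 0) => [i|]; [rewrite vE; ring|ring].
have Euu : A (fun i => u i ^+ 2) = m ^+ 2 + 2 * m * A y + A (fun i => y i ^+ 2).
  by apply: (q _ (m ^+ 2) (2 * m) 0 1 0 0) => [i|]; [rewrite uE; ring|ring].
have Euv : A (fun i => u i * v i) =
    m ^+ 2 + m * A y + m * A z + A (fun i => y i * z i).
  by apply: (q _ (m ^+ 2) m m 0 1 0) => [i|]; [rewrite uE vE; ring|ring].
have EC : A (fun i => y i ^+ 2 - V) = A (fun i => y i ^+ 2) - V.
  by apply: (q _ (- V) 0 0 1 0 0) => [i|]; ring.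
have EE : A (fun i => y i * (z i - S * y i)) =
    A (fun i => y i * z i) - S * A (fun i => y i ^+ 2).
  by apply: (q _ 0 0 0 (- S) 1 0) => [i|]; ring.
have denE : A (fun i => u i ^+ 2) - A u ^+ 2 = D.
  by rewrite Eu Euu /D EC; ring.
rewrite /sobol_S -/A denE (negbTE D0) EE.
rewrite -{1}[S](mulfK D0) -mulrBl; congr (_ / _).
by rewrite Euv Eu Ev /D EC; ring.
Qed.

Lemma sobol_T_error c m V S n u v :
  let y i := u i - m in let z i := v i - m in
  let A := @emp_mean R n.+1 in
  let b i := (y i + z i) / 2 in
  let D := V + A (fun i => (y i ^+ 2 + z i ^+ 2) / 2 - V) - A b ^+ 2 in
  D != 0 ->
  sobol_T c n.+1 u v - S =
  (A (fun i => y i * z i - S / 2 * (y i ^+ 2 + z i ^+ 2)) +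
    (S - 1) * A b ^+ 2) / D.
Proof.
move=> y z A b D D0.
have uE i : u i = y i + m by rewrite /y subrK.
have vE i : v i = z i + m by rewrite /z subrK.
have q k a0 a1 a2 a11 a12 a22 B : (forall i, k i = a0 + a1 * y i + a2 * z i +
    a11 * y i ^+ 2 + a12 * (y i * z i) + a22 * z i ^+ 2) ->
    a0 + a1 * A y + a2 * A z + a11 * A (fun i => y i ^+ 2) +
    a12 * A (fun i => y i * z i) + a22 * A (fun i => z i ^+ 2) = B ->
    A k = B.
  move=> h <-; rewrite /A -emp_mean_quadratic; congr (emp_mean _ _).
  exact/funext.
have Em : A (fun i => (u i + v i) / 2) = m + 2^-1 * A y + 2^-1 * A z.
  by apply: (q _ m 2^-1 2^-1 0 0 0) => [i|]; [rewrite uE vE; field|ring].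
have Eb : A b = 2^-1 * A y + 2^-1 * A z.
  by apply: (q _ 0 2^-1 2^-1 0 0 0) => [i|]; [rewrite /b; field|ring].
have Euv : A (fun i => u i * v i) =
    m ^+ 2 + m * A y + m * A z + A (fun i => y i * z i).
  by apply: (q _ (m ^+ 2) m m 0 1 0) => [i|]; [rewrite uE vE; ring|ring].
have Esq : A (fun i => (u i ^+ 2 + v i ^+ 2) / 2) =
    m ^+ 2 + m * A y + m * A z + 2^-1 * A (fun i => y i ^+ 2) +
    2^-1 * A (fun i => z i ^+ 2).
  by apply: (q _ (m ^+ 2) m m 2^-1 0 2^-1) => [i|]; [rewrite uE vE; field|ring].
have EC : A (fun i => (y i ^+ 2 + z i ^+ 2) / 2 - V) =
    - V + 2^-1 * A (fun i => y i ^+ 2) + 2^-1 * A (fun i => z i ^+ 2).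
  by apply: (q _ (- V) 0 0 2^-1 0 2^-1) => [i|]; [field|ring].
have EE : A (fun i => y i * z i - S / 2 * (y i ^+ 2 + z i ^+ 2)) =
    - (S / 2) * A (fun i => y i ^+ 2) + A (fun i => y i * z i) -
    (S / 2) * A (fun i => z i ^+ 2).
  by apply: (q _ 0 0 0 (- (S / 2)) 1 (- (S / 2))) => [i|]; [field|ring].
have denE : A (fun i => (u i ^+ 2 + v i ^+ 2) / 2) -
    A (fun i => (u i + v i) / 2) ^+ 2 = D.
  by rewrite Em Esq /D EC Eb; field.
rewrite /sobol_T -/A denE (negbTE D0) EE.
rewrite -{1}[S](mulfK D0) -mulrBl; congr (_ / _).
by rewrite Euv Em /D EC Eb; field.
Qed.

End estimator_algebra.

Section estimator_measurability.
Context d (T : measurableType d) (R : realType).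
Implicit Types (y yX : nat -> T -> R).

(** [a^-1 = a * (a ^+ 2)^-1] also at [a = 0], and powers of nonnegative numbers are
    measurable. *)
Lemma measurable_invr (g : T -> R) : measurable_fun setT g ->
  measurable_fun setT (fun w => (g w)^-1).
Proof.
move=> mg; rewrite (_ : (fun w => _) = fun w => g w * (g w ^+ 2) `^ (-1)).
  apply: measurable_funM => //.
  apply: (measurableT_comp (measurable_powR (-1))); exact: measurable_funX.
apply/funext => w; rewrite powR_inv1 ?sqr_ge0//.
have [->|g0] := eqVneq (g w) 0; first by rewrite invr0 mul0r.
by field.
Qed.

Lemma measurable_emp_mean n (u : nat -> T -> R) :
  (forall i, measurable_fun setT (u i)) ->
  measurable_fun setT (fun w => emp_mean n (fun i => u i w)).
Proof.
by move=> mu; apply: measurable_funM => //; apply: measurable_sum => i.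
Qed.

Lemma measurable_ratio (c : R) (num den : T -> R) :
  measurable_fun setT num -> measurable_fun setT den ->
  measurable_fun setT (fun w => if den w == 0 then c else num w / den w).
Proof.
move=> mn md; apply: measurable_fun_ifT => //.
  exact: measurable_fun_eqr.
by apply: measurable_funM => //; exact: measurable_invr.
Qed.

Lemma measurable_sobol_S c n y yX :
  (forall i, measurable_fun setT (y i)) -> (forall i, measurable_fun setT (yX i)) ->
  measurable_fun setT (fun w => sobol_S c n (y ^~ w) (yX ^~ w)).
Proof.
move=> my mX; apply: measurable_ratio; apply: measurable_funB.
- by apply: measurable_emp_mean => i; exact: measurable_funM.
- by apply: measurable_funM; exact: measurable_emp_mean.
- by apply: measurable_emp_mean => i; exact: measurable_funX.
- by apply: measurable_funX; exact: measurable_emp_mean.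
Qed.

Lemma measurable_sobol_T c n y yX :
  (forall i, measurable_fun setT (y i)) -> (forall i, measurable_fun setT (yX i)) ->
  measurable_fun setT (fun w => sobol_T c n (y ^~ w) (yX ^~ w)).
Proof.
move=> my mX.
have mm : measurable_fun setT
    (fun w => emp_mean n (fun i => (y i w + yX i w) / 2) ^+ 2).
  apply: measurable_funX; apply: measurable_emp_mean => i.
  by apply: measurable_funM => //; exact: measurable_funD.
apply: measurable_ratio; apply: measurable_funB => //.
- by apply: measurable_emp_mean => i; exact: measurable_funM.
- apply: measurable_emp_mean => i; apply: measurable_funM => //.
  by apply: measurable_funD; exact: measurable_funX.
Qed.

End estimator_measurability.

(** * Asymptotic normality of the Sobol estimators *)

Section sobol_clt.
Context d (T : measurableType d) (R : realType) (P : probability T R).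
Context d1 d2 (T1 : measurableType d1) (T2 : measurableType d2).
Variables (X : T -> T1) (Z Z' : T -> T2) (f : T1 * T2 -> R).
Hypotheses (mX : measurable_fun setT X) (mZ : measurable_fun setT Z)
  (mZ' : measurable_fun setT Z') (mf : measurable_fun setT f).
Hypotheses (XZ : independent P X Z) (ZZ : same_law P Z' Z)
  (Z'XZ : independent P Z' (fun w => (X w, Z w))).
Variables (W : nat -> T -> T1 * T2 * T2) (mW : forall i, measurable_fun setT (W i)).
Hypothesis iW : iid_copies P W (fun w => (X w, Z w, Z' w)).
Let Y w := f (X w, Z w).
Let YX w := f (X w, Z' w).
Hypotheses (Y2 : sqint P Y) (Y4 : intble P (fun w => Y w ^+ 4)).
Hypothesis (V0 : 0 < var P Y).
Let m := \int[P]_w Y w.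
Let V := var P Y.
Let S := sobol_index P X Y.

Let W0 w := (X w, Z w, Z' w).

Let mW0 : measurable_fun setT W0.
Proof. by apply: measurable_fun_pair => //; exact: measurable_fun_pair. Qed.

Let y (x : T1 * T2 * T2) := f x.1 - m.
Let z (x : T1 * T2 * T2) := f (x.1.1, x.2) - m.

Let my : measurable_fun setT y.
Proof. by apply: measurable_funB => //; exact: measurableT_comp. Qed.

Let mz : measurable_fun setT z.
Proof.
apply: measurable_funB => //; apply: (measurableT_comp mf).
by apply: measurable_fun_pair => //; exact: measurableT_comp.
Qed.

Let mXZ := measurable_fun_pair mX mZ.
Let mXZ' := measurable_fun_pair mX mZ'.
Let copy := copy_same_law mX mZ mZ' XZ ZZ Z'XZ.

(* (X, Z') and (X, Z) have the same law, so Y and YX have the same moments *)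
Let transfer (h : R -> R) : measurable_fun setT h ->
  (intble P (fun w => h (Y w)) -> intble P (fun w => h (YX w))) /\
  \int[P]_w h (YX w) = \int[P]_w h (Y w).
Proof.
move=> mh; have mhf : measurable_fun setT (h \o f) by exact: measurableT_comp.
split.
  exact: (@same_law_integrable _ _ _ _ _ _ _ _ (h \o f) mXZ' mXZ copy mhf).
rewrite /Rintegral; congr fine.
apply: (@same_law_integral _ _ _ _ _ _ _ _ (EFin \o (h \o f)) mXZ' mXZ copy).
exact/measurable_EFinP.
Qed.

Let mY : measurable_fun setT Y. Proof. exact: measurableT_comp. Qed.
Let mYX : measurable_fun setT YX. Proof. exact: measurableT_comp. Qed.

Let YY2 : sqint P (fun w => Y w ^+ 2).
Proof.
split; first exact: measurable_funX.
by apply: eq_integrable Y4 => // w _; rewrite /= -exprM.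
Qed.

Let YX2 : sqint P YX.
Proof.
split => //; apply: (transfer (h := fun u => u ^+ 2) _).1; last exact: Y2.2.
exact: measurable_funX.
Qed.

Let YYX2 : sqint P (fun w => YX w ^+ 2).
Proof.
split; first exact: measurable_funX.
apply: (transfer (h := fun u => (u ^+ 2) ^+ 2) _).1; last exact: YY2.2.
by do 2 apply: measurable_funX.
Qed.

Let y2 : sqint P (fun w => y (W0 w)).
Proof. exact: sqintB Y2 (sqint_cst P m). Qed.

Let z2 : sqint P (fun w => z (W0 w)).
Proof. exact: sqintB YX2 (sqint_cst P m). Qed.

Let sqint_shift (U : T -> R) : sqint P U -> sqint P (fun w => U w ^+ 2) ->
  sqint P (fun w => (U w - m) ^+ 2).
Proof.
move=> u1 u2.
have := sqintD (sqintB u2 (sqintZ (2 * m) u1)) (sqint_cst P (m ^+ 2)).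
rewrite (_ : (fun w => _) = (fun w => (U w - m) ^+ 2))//.
by apply/funext => w; ring.
Qed.

Let yy2 : sqint P (fun w => y (W0 w) ^+ 2).
Proof. exact: sqint_shift. Qed.

Let zz2 : sqint P (fun w => z (W0 w) ^+ 2).
Proof. exact: sqint_shift. Qed.

Let yz2 : sqint P (fun w => y (W0 w) * z (W0 w)).
Proof.
split; first by apply: measurable_funM; [exact: y2.1|exact: z2.1].
have := sqint_mul yy2 zz2.
by apply: eq_integrable => // w _; rewrite /= exprMn.
Qed.

Let y_mean : \int[P]_w y (W0 w) = 0.
Proof.
rewrite RintegralB//; [|exact: sqint_intble Y2|exact: intble_cst].
by rewrite Rint_cst subrr.
Qed.

Let z_mean : \int[P]_w z (W0 w) = 0.
Proof.
rewrite RintegralB//; [|exact: sqint_intble YX2|exact: intble_cst].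
by rewrite Rint_cst (transfer (h := id) _).2 ?subrr//; exact: measurable_id.
Qed.

Let yy_mean : \int[P]_w y (W0 w) ^+ 2 = V.
Proof. by rewrite /V varE. Qed.

Let zz_mean : \int[P]_w z (W0 w) ^+ 2 = V.
Proof.
rewrite /V varE (transfer (h := fun u => (u - m) ^+ 2) _).2//.
by apply: measurable_funX; exact: measurable_funB.
Qed.

Let yz_mean : \int[P]_w (y (W0 w) * z (W0 w)) = S * V.
Proof.
rewrite /S /sobol_index (sobol_var mX mZ mZ' mf XZ ZZ Z'XZ Y2) divfK//.
by rewrite gt_eqF.
Qed.

Let kB x := (y x + z x) / 2.
Let kCS x := y x ^+ 2 - V.
Let kCT x := (y x ^+ 2 + z x ^+ 2) / 2 - V.
Let kES x := y x * (z x - S * y x).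
Let kET x := y x * z x - S / 2 * (y x ^+ 2 + z x ^+ 2).

Let hy : centered_sqint P W0 y. Proof. by []. Qed.
Let hz : centered_sqint P W0 z. Proof. by []. Qed.

Let hB : centered_sqint P W0 kB.
Proof.
have E w : kB (W0 w) = 2^-1 * (y (W0 w) + z (W0 w)) by rewrite /kB mulrC.
split.
- by apply: measurable_funM => //; exact: measurable_funD.
- by under eq_fun do rewrite E; apply: sqintZ; exact: sqintD.
- under eq_Rintegral do rewrite E.
  rewrite Rint_scale; last by apply: measurable_funD; [exact: y2.1|exact: z2.1].
  by rewrite RintegralD// ?y_mean ?z_mean ?addr0 ?mulr0//; exact: sqint_intble.
Qed.

Let hCS : centered_sqint P W0 kCS.
Proof.
split.
- by apply: measurable_funB => //; exact: measurable_funX.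
- exact: sqintB yy2 (sqint_cst P V).
- rewrite RintegralB//; [|exact: sqint_intble yy2|exact: intble_cst].
  by rewrite Rint_cst yy_mean subrr.
Qed.

Let hCT : centered_sqint P W0 kCT.
Proof.
have E w : kCT (W0 w) = 2^-1 * (y (W0 w) ^+ 2 + z (W0 w) ^+ 2) - V.
  by rewrite /kCT mulrC.
have s2 := sqintZ 2^-1 (sqintD yy2 zz2).
split.
- apply: measurable_funB => //; apply: measurable_funM => //.
  by apply: measurable_funD; exact: measurable_funX.
- by under eq_fun do rewrite E; exact: sqintB s2 (sqint_cst P V).
- under eq_Rintegral do rewrite E.
  rewrite RintegralB//; [|exact: sqint_intble s2|exact: intble_cst].
  rewrite RintegralZl//; last exact: sqint_intble (sqintD yy2 zz2).
  rewrite RintegralD//; [|exact: sqint_intble yy2|exact: sqint_intble zz2].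
  by rewrite Rint_cst yy_mean zz_mean; field.
Qed.

Let hES : centered_sqint P W0 kES.
Proof.
have E w : kES (W0 w) = y (W0 w) * z (W0 w) - S * y (W0 w) ^+ 2.
  by rewrite /kES; ring.
have s2 := sqintZ S yy2.
split.
- apply: measurable_funM => //; apply: measurable_funB => //.
  exact: measurable_funM.
- by under eq_fun do rewrite E; exact: sqintB yz2 s2.
- under eq_Rintegral do rewrite E.
  rewrite RintegralB//; [|exact: sqint_intble yz2|exact: sqint_intble s2].
  rewrite RintegralZl//; last exact: sqint_intble yy2.
  by rewrite yz_mean yy_mean subrr.
Qed.

Let hET : centered_sqint P W0 kET.
Proof.
have s2 := sqintZ (S / 2) (sqintD yy2 zz2).
split.
- apply: measurable_funB; first exact: measurable_funM.
  apply: measurable_funM => //.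
  by apply: measurable_funD; exact: measurable_funX.
- exact: sqintB yz2 s2.
- rewrite RintegralB//; [|exact: sqint_intble yz2|exact: sqint_intble s2].
  rewrite RintegralZl//; last exact: sqint_intble (sqintD yy2 zz2).
  rewrite RintegralD//; [|exact: sqint_intble yy2|exact: sqint_intble zz2].
  by rewrite yz_mean yy_mean zz_mean; field.
Qed.

Let Ys w i := f (W i w).1.
Let YXs w i := f ((W i w).1.1, (W i w).2).

Let mYs i : measurable_fun setT (fun w => Ys w i).
Proof. by apply: (measurableT_comp mf); exact: measurableT_comp. Qed.

Let mYXs i : measurable_fun setT (fun w => YXs w i).
Proof.
apply: (measurableT_comp mf); apply: measurable_fun_pair.
  by apply: measurableT_comp => //; exact: measurableT_comp.
exact: measurableT_comp.
Qed.

Lemma sobol_S_clt c :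
  cvg_in_distribution P
    (fun N w => Num.sqrt N%:R * (sobol_S c N (Ys w) (YXs w) - S))
    (gaussian 0 (var P (fun w => (Y w - m) * ((YX w - m) - S * (Y w - m)))
      / V ^+ 2)).
Proof.
have -> : var P (fun w => (Y w - m) * ((YX w - m) - S * (Y w - m))) =
    \int[P]_w kES (W0 w) ^+ 2.
  have [_ _ E] := hES.
  by rewrite varE; apply: eq_Rintegral => w _; rewrite E subr0.
apply: (ratio_clt (Kt := `|S| + 1) mW mW0 iW hy hz hCS hES) => //.
- by move=> n; exact: measurable_sobol_S.
move=> n w D D0.
exists (S * emp_mean n.+1 (fun i => y (W i w)) ^+ 2 -
  emp_mean n.+1 (fun i => y (W i w)) * emp_mean n.+1 (fun i => z (W i w))).
  move: (emp_mean _ (fun i => z _)) (emp_mean _ (fun i => y _)) => b a.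
  rewrite (le_trans (ler_normB _ _))// mulrDl mul1r lerD//.
    by rewrite normrM (ger0_norm (sqr_ge0 a)) ler_wpM2l// lerDl sqr_ge0.
  have ha := sqr_ge0 a; have hb := sqr_ge0 b.
  have h1 := sqr_ge0 (a + b); have h2 := sqr_ge0 (a - b).
  by rewrite ler_norml; apply/andP; split; nra.
exact: (@sobol_S_error _ c m V S n (Ys w) (YXs w) D0).
Qed.

Lemma sobol_T_clt c :
  cvg_in_distribution P
    (fun N w => Num.sqrt N%:R * (sobol_T c N (Ys w) (YXs w) - S))
    (gaussian 0 (var P (fun w => (Y w - m) * (YX w - m) -
        S / 2 * ((Y w - m) ^+ 2 + (YX w - m) ^+ 2)) / V ^+ 2)).
Proof.
have -> : var P (fun w => (Y w - m) * (YX w - m) -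
        S / 2 * ((Y w - m) ^+ 2 + (YX w - m) ^+ 2)) =
    \int[P]_w kET (W0 w) ^+ 2.
  have [_ _ E] := hET.
  by rewrite varE; apply: eq_Rintegral => w _; rewrite E subr0.
apply: (ratio_clt (Kt := `|S| + 1) mW mW0 iW hB hB hCT hET) => //.
- by move=> n; exact: measurable_sobol_T.
move=> n w D D0.
exists ((S - 1) * emp_mean n.+1 (fun i => kB (W i w)) ^+ 2).
  rewrite normrM (ger0_norm (sqr_ge0 _)) ler_pM ?sqr_ge0//.
    by rewrite (le_trans (ler_normB _ _))// normr1.
  by rewrite lerDl sqr_ge0.
exact: (@sobol_T_error _ c m V S n (Ys w) (YXs w) D0).
Qed.

End sobol_clt.

Theorem proposition2p2 (R : realType) (d : measure_display)
  (T : measurableType d) (P : probability T R) (p1 p2 : nat)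
  (X : {RV P >-> p1.-tuple R}) (Z Z' : {RV P >-> p2.-tuple R})
  (f : p1.-tuple R * p2.-tuple R -> R)
  (Xs : nat -> {RV P >-> p1.-tuple R})
  (Zs Zs' : nat -> {RV P >-> p2.-tuple R})
  (cS cT : R) :
  let Y := fun w => f (X w, Z w) in
  let YX := fun w => f (X w, Z' w) in
  let Ys := fun w i => f (Xs i w, Zs i w) in
  let YXs := fun w i => f (Xs i w, Zs' i w) in
  let SX := sobol_index P X Y in
  let EY := mean P Y in
  let sigma2_S :=
    var P (fun w => (Y w - EY) * ((YX w - EY) - SX * (Y w - EY)))
      / (var P Y) ^+ 2 in
  let sigma2_T :=
    var P (fun w => (Y w - EY) * (YX w - EY)
                    - SX / 2 * ((Y w - EY) ^+ 2 + (YX w - EY) ^+ 2))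
      / (var P Y) ^+ 2 in
  measurable_fun setT f ->
  independent P X Z ->
  same_law P Z' Z ->
  independent P Z' (fun w => (X w, Z w)) ->
  Y \in Lfun P 2%:E ->
  ('V_P[Y] <> 0)%E ->
  iid_copies P (fun i w => (Xs i w, Zs i w, Zs' i w))
               (fun w => (X w, Z w, Z' w)) ->
  ('E_P[fun w => (Y w ^+ 4)%R] < +oo)%E ->
  cvg_in_distribution P
    (fun N w => Num.sqrt N%:R * (sobol_S cS N (Ys w) (YXs w) - SX))
    (gaussian 0 sigma2_S)
  /\
  cvg_in_distribution P
    (fun N w => Num.sqrt N%:R * (sobol_T cT N (Ys w) (YXs w) - SX))
    (gaussian 0 sigma2_T).
Proof.
move=> Y YX Ys YXs SX EY sigma2_S sigma2_T mf XZ ZZ Z'XZ Y2 V0 iW Y4.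
have mX : measurable_fun setT X by [].
have mZ : measurable_fun setT Z by [].
have mZ' : measurable_fun setT Z' by [].
have mY : measurable_fun setT Y.
  by apply: (measurableT_comp mf); exact: measurable_fun_pair.
have sY : sqint P Y.
  by split => //; exact: Lfun2_integrable_sqr Y2.
have iY4 : intble P (fun w => Y w ^+ 4).
  apply/integrableP; split; first exact/measurable_EFinP/measurable_funX.
  move: Y4; rewrite unlock; apply: le_lt_trans.
  rewrite le_eqVlt; apply/orP; left; apply/eqP; apply: eq_integral => w _.
  by rewrite /= ger0_norm// (exprM _ 2 2) sqr_ge0.
have V1 : 0 < var P Y.
  have vE : 'V_P[Y]%E = (var P Y)%:E by rewrite fineK//; exact: variance_fin_num.
  have : (0 <= 'V_P[Y])%E by exact: variance_ge0.
  rewrite vE lee_fin le_eqVlt => /predU1P[v0|//].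
  by exfalso; apply: V0; rewrite vE -v0.
have mW i : measurable_fun setT (fun w => (Xs i w, Zs i w, Zs' i w)).
  by apply: measurable_fun_pair => //; exact: measurable_fun_pair.
have hS := sobol_S_clt mX mZ mZ' mf XZ ZZ Z'XZ mW iW sY iY4 V1 cS.
have hT := sobol_T_clt mX mZ mZ' mf XZ ZZ Z'XZ mW iW sY iY4 V1 cT.
rewrite -(meanE P Y) in hS hT.
split; [exact: hS|exact: hT].
Qed.
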